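(* Let $p,n\geq 1$ be integers and let $0\leq\alpha<1$. If $f\in\mathcal{A}_{p,n}$ satisfies \[\operatorname{Re}\left(1+\frac{zf''(z)}{f'(z)}\right)>\frac{(2p-n)+\alpha(2p+n)}{2(\alpha+1)}\qquad\text{for all } z\in\mathbb{D},\] then \[\operatorname{Re}\left(\frac{f'(z)}{pz^{p-1}}\right)>\frac{1+\alpha}{2}\qquad\text{for all } z\in\mathbb{D}.\]
   Context: $\mathbb{D}=\{z\in\mathbb{C}:|z|<1\}$ is the open unit disk. For positive integers $p,n$, $\mathcal{A}_{p,n}$ is the class of all analytic functions $f:\mathbb{D}\to\mathbb{C}$ whose power series at $0$ has the form $f(z)=z^{p}+a_{n+p}z^{n+p}+a_{n+p+1}z^{n+p+1}+\cdots$. Quotients are understood as meromorphic functions on $\mathbb{D}$ with removable singularities removed; so at $z=0$ the function $1+zf''(z)/f'(z)$ has value $p$ and $f'(z)/(pz^{p-1})$ has value $1$. An inequality assumed on $\mathbb{D}$ includes that the expression has no poles in $\mathbb{D}$. *)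

(* Defs.v *)
From Stdlib Require Import Reals.
From Coquelicot Require Import Coquelicot.

Definition in_disk (z : C) : Prop := (Cmod z < 1)%R.

(* Functions on the disk are represented by total functions [C -> C]; since
   the disk is open, [ex_derive] and [C_derive] at its points do not depend on
   the values taken outside of it. *)
Definition class_A (p n : nat) (f : C -> C) : Prop :=
  (forall z : C, in_disk z ->
     @ex_derive C_AbsRing C_NormedModule f z) /\
  exists a : nat -> C,
    (forall k : nat, (k < p)%nat -> a k = RtoC 0) /\
    a p = RtoC 1 /\
    (forall k : nat, (p < k < n + p)%nat -> a k = RtoC 0) /\
    (forall z : C, in_disk z ->
       @is_pseries C_AbsRing C_NormedModule a z (f z)).

(* [v] is the value at [z] of the meromorphic function [g] once removable
   singularities are removed: the limit of [g w] as [w] tends to [z] with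
   [w <> z].  No such [v] exists when [z] is a pole of [g].  The limit ignores
   [g z] itself, so the convention [/ 0 = 0] at a zero of a denominator is
   harmless. *)
Definition merom_value (g : C -> C) (z v : C) : Prop :=
  filterlim g (@locally' C_UniformSpace z) (@locally C_UniformSpace v).

Definition Re_gt_on_disk (g : C -> C) (c : R) : Prop :=
  forall z : C, in_disk z -> exists v : C, merom_value g z v /\ (Re v > c)%R.

(* Main.v *)
(* With q = f'/(p z^(p-1)) = 1 + c_n z^n + ..., one has 1 + z f''/f' = p + z q'/q.
   Put gamma = (1+alpha)/2 and suppose that Re q <= gamma somewhere.  On the first
   circle where this happens there is z0 with Re q(z0) = gamma and Re q >= gamma
   on |z| = |z0|.  By Jack's lemma W = z0 q'(z0) is then real, with
   W <= - n |q(z0) - 1|^2 / (2 (1 - gamma)), so that Re (p + W/q(z0)) is at most the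
   bound assumed on Re (1 + z f''/f'): a contradiction.

   Jack's lemma is obtained without the maximum principle.  Write
   u(zeta) = Re q(z0 zeta) - gamma >= 0, which vanishes at zeta = 1.  For
   |lambda| = 1 the kernel 2 (1 - Re (lambda zeta^-n)) / |1 - zeta|^2 is nonnegative,
   and averaging u against it over the roots of zeta^N = -1 gives, as N grows,
   (Re lambda - 1) Re W - n Re (lambda (q(z0) - 1)) >= 0.  The optimal lambda is
   - conj B / B with B = q(z0) - 1. *)
Require Import Defs.
From Stdlib Require Import Reals Lra Lia Psatz.
From Coquelicot Require Import Coquelicot.
Local Open Scope R_scope.

(* Equalities stated in the carrier of a canonical structure are not recognized by
   [ring] and [field]. *)
Ltac C_eq := match goal with |- @eq _ ?u ?v => change (@eq C u v) end.
Ltac R_eq := match goal with |- @eq _ ?u ?v => change (@eq R u v) end.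

(** * The boundary inequality *)

Lemma sum_n_C_mult_l (c : C) (u : nat -> C) (m : nat) :
  sum_n (fun k => (c * u k)%C) m = (c * sum_n u m)%C :> C.
Proof. exact (@sum_n_mult_l C_Ring c u m). Qed.

Lemma sum_n_C_ext (u v : nat -> C) (m : nat) :
  (forall k, (k <= m)%nat -> u k = v k) -> sum_n u m = sum_n v m :> C.
Proof. exact (sum_n_ext_loc u v m). Qed.

Lemma sum_n_C_plus (u v : nat -> C) (m : nat) :
  sum_n (fun k => (u k + v k)%C) m = (sum_n u m + sum_n v m)%C :> C.
Proof. exact (@sum_n_plus C_AbelianMonoid u v m). Qed.

Lemma sum_n_C_S (u : nat -> C) (m : nat) :
  sum_n u (S m) = (sum_n u m + u (S m))%C :> C.
Proof. exact (sum_Sn u m). Qed.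

Lemma Re_sum_n (u : nat -> C) (m : nat) :
  Re (sum_n u m) = sum_n (fun k => Re (u k)) m.
Proof.
induction m as [|m IH]; [now rewrite !sum_O|].
now rewrite sum_n_C_S, sum_Sn, <- IH.
Qed.

Lemma sum_n_C_const (c : C) (m : nat) :
  sum_n (fun _ => c) m = (RtoC (INR (S m)) * c)%C :> C.
Proof.
induction m as [|m IH]; [rewrite sum_O; simpl; ring|].
rewrite sum_n_C_S, IH, (S_INR (S m)), RtoC_plus. ring.
Qed.

Lemma sum_n_C_geom (w : C) (m : nat) :
  ((1 - w) * sum_n (Cpow w) m = 1 - w ^ S m)%C.
Proof.
induction m as [|m IH]; [rewrite sum_O; simpl; ring|].
rewrite sum_n_C_S, Cmult_plus_distr_l, IH, !Cpow_S. ring.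
Qed.

(** Throughout, the pair [(cos t, sin t)] plays the role of exp(it). *)
Lemma Cexp_add (s t : R) :
  ((cos s, sin s) * (cos t, sin t))%C = (cos (s + t), sin (s + t)).
Proof. rewrite cos_plus, sin_plus. unfold Cmult; simpl. f_equal; ring. Qed.

Lemma Cexp_pow (t : R) (k : nat) :
  Cpow (cos t, sin t) k = (cos (INR k * t), sin (INR k * t)).
Proof.
induction k as [|k IH].
- simpl. rewrite Rmult_0_l, cos_0, sin_0. reflexivity.
- rewrite Cpow_S, IH, Cexp_add, S_INR.
  now replace (t + INR k * t) with ((INR k + 1) * t) by ring.
Qed.

Lemma Cmod_cos_sin (t : R) : Cmod (cos t, sin t) = 1.
Proof.
unfold Cmod; simpl. replace (_ + _) with (Rsqr (sin t) + Rsqr (cos t)) by (unfold Rsqr; ring).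
rewrite sin2_cos2. exact sqrt_1.
Qed.

Lemma cos_sin_neq_1 (t : R) : 0 < t < 2 * PI -> (cos t, sin t) <> RtoC 1.
Proof.
intros Ht E. injection E as Ec _.
replace t with (2 * (t / 2)) in Ec by field.
rewrite cos_2a_sin in Ec.
assert (0 < sin (t / 2)) by (apply sin_gt_0; lra).
nra.
Qed.

(** The nodes are exp(i pi (2j+1)/N) with N = m + 1. Roots of -1 rather than of 1 keep the nodes
    away from 1, where the kernel is singular. *)
Lemma roots_of_minus_one (m : nat) :
  exists zeta : nat -> C,
    (forall j, Cmod (zeta j) = 1 /\ Cpow (zeta j) (S m) = RtoC (-1)) /\
    (forall k, (0 < k <= m)%nat -> sum_n (fun j => Cpow (zeta j) k) m = RtoC 0 :> C).
Proof.
set (N := INR (S m)).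
assert (HN : 0 < N) by (apply lt_0_INR; lia).
exists (fun j => (cos (PI / N * (2 * INR j + 1)), sin (PI / N * (2 * INR j + 1)))).
split.
- intros j. split; [apply Cmod_cos_sin|].
  rewrite Cexp_pow. fold N.
  replace (N * (PI / N * (2 * INR j + 1))) with (PI + 2 * INR j * PI) by (field; lra).
  rewrite cos_period, sin_period, cos_PI, sin_PI. reflexivity.
- intros k Hk.
  (* The k-th powers of the nodes form a geometric progression in j with ratio [w]. Here [w <> 1]
     because 0 < k < N, while w^N = 1. *)
  pose (w := (cos (INR k * (2 * PI / N)), sin (INR k * (2 * PI / N))) : C).
  assert (Hkr : 0 < INR k < N) by (split; [apply lt_0_INR | apply lt_INR]; lia).
  pose proof PI_RGT_0 as HPI.
  assert (Hw : w <> RtoC 1).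
  { apply cos_sin_neq_1. split.
    - apply Rmult_lt_0_compat; [lra|]. apply Rdiv_lt_0_compat; lra.
    - replace (2 * PI) with (N * (2 * PI / N)) at 2 by (field; lra).
      apply Rmult_lt_compat_r; [apply Rdiv_lt_0_compat; lra | lra]. }
  rewrite (sum_n_C_ext _ (fun j => ((cos (INR k * (PI / N)), sin (INR k * (PI / N))) * Cpow w j)%C)).
  2:{ intros j _. unfold w. rewrite !Cexp_pow, Cexp_add.
      replace (INR k * (PI / N * (2 * INR j + 1)))
        with (INR k * (PI / N) + INR j * (INR k * (2 * PI / N))) by (field; lra).
      reflexivity. }
  rewrite sum_n_C_mult_l.
  assert (E := sum_n_C_geom w m).
  assert (Hpow : Cpow w (S m) = RtoC 1).
  { unfold w. rewrite Cexp_pow. fold N.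
    replace (N * (INR k * (2 * PI / N))) with (0 + 2 * INR k * PI) by (field; lra).
    rewrite cos_period, sin_period, cos_0, sin_0. reflexivity. }
  rewrite Hpow in E.
  assert (Hw' : (1 - w)%C <> RtoC 0).
  { intros E0. apply Hw. replace w with (1 - (1 - w))%C by ring. rewrite E0. ring. }
  replace (sum_n (Cpow w) m) with (((1 - w) * sum_n (Cpow w) m) / (1 - w))%C
    by (field; exact Hw').
  rewrite E. field. exact Hw'.
Qed.

(** * Weighted averages over the roots of -1 *)

Section RootAverages.

Variable m : nat.
Variable zeta : nat -> C.
Hypothesis zeta_mod : forall j, Cmod (zeta j) = 1.
Hypothesis zeta_pow : forall j, Cpow (zeta j) (S m) = RtoC (-1).
Hypothesis zeta_sum : forall k, (0 < k <= m)%nat -> sum_n (fun j => Cpow (zeta j) k) m = RtoC 0 :> C.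

Let N := RtoC (INR (S m)).

Lemma zeta_neq_0 j : zeta j <> RtoC 0.
Proof. intros E. generalize (zeta_mod j). rewrite E, Cmod_0. lra. Qed.

Lemma zeta_neq_1 j : (1 - zeta j)%C <> RtoC 0.
Proof.
intros E. assert (E1 : zeta j = RtoC 1) by (replace (zeta j) with (1 - (1 - zeta j))%C by ring; rewrite E; ring).
generalize (zeta_pow j). rewrite E1, Cpow_1_l. intros H. injection H. lra.
Qed.

(** Write T(k) for the sum. Consecutive values differ by the k-th power sum of the nodes, so T is
    constant on 1..N and T(0) = T(1) + N. Since zeta^N = -1, also T(N) = -T(0); hence 2 T(1) =
    -N. *)
Lemma sum_zeta_over_1_minus_zeta k :
  (0 < k <= S m)%nat -> sum_n (fun j => (zeta j ^ k / (1 - zeta j))%C) m = (- N / 2)%C :> C.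
Proof.
set (T k := sum_n (fun j => (zeta j ^ k / (1 - zeta j))%C) m : C).
assert (step : forall k, (T k = T (S k) + sum_n (fun j => Cpow (zeta j) k) m)%C).
{ intros i. unfold T. rewrite <- sum_n_C_plus. apply sum_n_C_ext. intros j _.
  rewrite Cpow_S. field. apply zeta_neq_1. }
assert (HT : forall k, (k <= m)%nat -> T (S k) = T 1%nat).
{ intros i. induction i as [|i IH]; intros Hi; [reflexivity|].
  rewrite <- IH by lia. rewrite (step (S i)), zeta_sum by lia. ring. }
assert (HN : T (S m) = (- T 0%nat)%C).
{ unfold T. replace (- _)%C with (RtoC (-1) * sum_n (fun j : nat => (zeta j ^ 0 / (1 - zeta j))%C) m)%C by ring.
  rewrite <- sum_n_C_mult_l. apply sum_n_C_ext. intros j _. rewrite zeta_pow. simpl.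
  field. apply zeta_neq_1. }
assert (H0 := step 0%nat).
rewrite (sum_n_C_ext _ (fun _ => RtoC 1)), sum_n_C_const in H0 by reflexivity.
rewrite (HT m) in HN by lia. fold N in H0.
intros Hk. change (T k = (- N / 2)%C).
destruct k as [|k]; [lia|]. rewrite HT by lia.
assert (H2 : (2 * T 1%nat = - N)%C).
{ replace (2 * T 1%nat)%C with (T 1%nat + T 1%nat)%C by ring.
  rewrite HN at 1. rewrite H0. ring. }
replace (T 1%nat) with ((2 * T 1%nat) / 2)%C by field. rewrite H2. reflexivity.
Qed.

(** For |zeta| = 1 this weight is 1/|1 - zeta|^2. The conjugate is written as an inverse so that
    identities about it are rational in zeta. *)
Let wt j := (/ ((1 - zeta j) * (1 - / zeta j)))%C.

Lemma one_minus_inv_zeta j : (1 - / zeta j)%C <> RtoC 0.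
Proof.
intros E. apply (zeta_neq_1 j).
replace (1 - zeta j)%C with (- zeta j * (1 - / zeta j))%C by (field; apply zeta_neq_0).
rewrite E. ring.
Qed.

(** Raising k by one changes the summand by -zeta^(k+1)/(1 - zeta), whose sum over the nodes is
    N/2. *)
Lemma sum_wt_pow k :
  (k <= S m)%nat -> sum_n (fun j => ((1 - zeta j ^ k) * wt j)%C) m = (N * INR k / 2)%C :> C.
Proof.
induction k as [|k IH]; intros Hk.
- rewrite (sum_n_C_ext _ (fun _ => RtoC 0)) by (intros j _; simpl; ring).
  rewrite sum_n_C_const. simpl. field.
- rewrite (sum_n_C_ext _ (fun j => ((1 - zeta j ^ k) * wt j + (-1) * (zeta j ^ S k / (1 - zeta j)))%C)).
  + rewrite sum_n_C_plus, sum_n_C_mult_l, IH, sum_zeta_over_1_minus_zeta by lia.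
    rewrite S_INR, RtoC_plus. field.
  + intros j _. unfold wt. rewrite Cpow_S.
    assert (H1 := zeta_neq_1 j). assert (H0 := zeta_neq_0 j). assert (H2 := one_minus_inv_zeta j).
    field. repeat split; try assumption.
    intros E. apply H1. replace (1 - zeta j)%C with (- (zeta j - 1))%C by ring. rewrite E; ring.
Qed.

(** The case k = N of [sum_wt_pow], in which 1 - zeta^N = 2. *)
Lemma sum_wt : sum_n wt m = (N * N / 4)%C :> C.
Proof.
assert (E := sum_wt_pow (S m) (le_n _)). fold N in E.
rewrite (sum_n_C_ext _ (fun j => (2 * wt j)%C)) in E.
2:{ intros j _. rewrite zeta_pow. replace (1 - RtoC (-1))%C with (RtoC 2); [reflexivity|].
  rewrite <- RtoC_minus. f_equal. ring. }
rewrite sum_n_C_mult_l in E.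
replace (sum_n wt m) with ((2 * sum_n wt m) / 2)%C by field. rewrite E. field.
Qed.

(** Since zeta^(-k) = -zeta^(N-k), negative powers reduce to [sum_wt] and [sum_wt_pow]. *)
Lemma sum_wt_inv_pow k :
  (k <= S m)%nat -> sum_n (fun j => ((1 - / zeta j ^ k) * wt j)%C) m = (N * INR k / 2)%C :> C.
Proof.
intros Hk.
rewrite (sum_n_C_ext _ (fun j => (2 * wt j + (-1) * ((1 - zeta j ^ (S m - k)) * wt j))%C)).
- rewrite sum_n_C_plus, !sum_n_C_mult_l, sum_wt, sum_wt_pow by lia.
  rewrite minus_INR, RtoC_minus by lia. fold N. field.
- intros j _. assert (E := zeta_pow j).
  replace (S m) with (k + (S m - k))%nat in E by lia. rewrite Cpow_add_r in E.
  assert (Hz : Cpow (zeta j) k <> RtoC 0) by (apply Cpow_nz, zeta_neq_0).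
  replace (/ zeta j ^ k)%C with (- zeta j ^ (S m - k))%C; [ring|].
  replace (zeta j ^ (S m - k))%C with ((zeta j ^ k * zeta j ^ (S m - k)) / zeta j ^ k)%C by (field; exact Hz).
  rewrite E. field. exact Hz.
Qed.

Lemma inv_zeta j : (/ zeta j)%C = Cconj (zeta j).
Proof.
assert (E := Cmod2_conj (zeta j)). rewrite zeta_mod in E.
assert (H0 := zeta_neq_0 j).
replace (Cconj (zeta j)) with ((zeta j * Cconj (zeta j)) / zeta j)%C by (field; exact H0).
rewrite <- E. replace (1 ^ 2) with 1 by ring. field. exact H0.
Qed.

Lemma wt_real j : exists r : R, 0 <= r /\ wt j = RtoC r.
Proof.
exists (/ (Cmod (1 - zeta j) ^ 2)).
assert (H := proj1 (Cmod_gt_0 _) (zeta_neq_1 j)).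
split; [left; apply Rinv_0_lt_compat; nra|].
rewrite RtoC_inv, Cmod2_conj, Cminus_conj, <- inv_zeta.
unfold wt. do 3 f_equal. unfold Cconj, RtoC; simpl; f_equal; ring.
nra.
Qed.

Variables (n : nat) (lambda : C).
Hypothesis lambda_mod : Cmod lambda = 1.

Let ker j := ((2 - lambda / zeta j ^ n - Cconj lambda * zeta j ^ n) * wt j)%C.

(** With x = lambda zeta^(-n), of modulus 1, the first factor of [ker] is 2 - 2 Re x, which lies in
    [0, 4]. The upper bound controls the error when the averaged function is only known to be at
    least -tau. *)
Lemma ker_bounds j : exists r : R, ker j = RtoC r /\ 0 <= r <= Re (4 * wt j)%C.
Proof.
destruct (wt_real j) as [r [Hr E]].
set (x := (lambda / zeta j ^ n)%C).
assert (Hx : Cmod x = 1).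
{ unfold x. rewrite Cmod_div by apply Cpow_nz, zeta_neq_0.
  rewrite Cmod_pow, zeta_mod, pow1, lambda_mod. field. }
assert (Hc : (Cconj lambda * zeta j ^ n)%C = Cconj x).
{ unfold x. rewrite Cdiv_conj by apply Cpow_nz, zeta_neq_0.
  rewrite Cpow_conj, <- inv_zeta, Cpow_inv by apply zeta_neq_0.
  field. apply Cpow_nz, zeta_neq_0. }
unfold ker. rewrite Hc, E. fold x.
assert (Hre := re_le_Cmod x). rewrite Hx in Hre. apply Rabs_le_between in Hre.
exists ((2 - 2 * Re x) * r). split.
- destruct x as [a b]. unfold Cminus, Cplus, Copp, Cmult, Cconj, RtoC; simpl. f_equal; ring.
- replace (Re (4 * r)%C) with (4 * r) by (simpl; ring). nra.
Qed.

(** Expanding the product leaves weighted sums of 1 - zeta^d with d among k, -n, k - n, n and k + n.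
    The hypotheses keep these exponents in the range where such sums are linear in |d|. *)
Lemma sum_ker_pow k :
  (n <= k)%nat -> (k + n <= S m)%nat ->
  sum_n (fun j => ((zeta j ^ k - 1) * ker j)%C) m =
  (N / 2 * (INR k * (lambda + Cconj lambda - 2) - 2 * INR n * lambda))%C :> C.
Proof.
intros Hnk Hk.
rewrite (sum_n_C_ext _ (fun j =>
   ((-2) * ((1 - zeta j ^ k) * wt j) +
    ((- lambda) * ((1 - / zeta j ^ n) * wt j) +
    (lambda * ((1 - zeta j ^ (k - n)) * wt j) +
    (((- Cconj lambda) * ((1 - zeta j ^ n) * wt j)) +
     (Cconj lambda * ((1 - zeta j ^ (k + n)) * wt j))))))%C)).
- rewrite !sum_n_C_plus, !sum_n_C_mult_l, !sum_wt_pow, sum_wt_inv_pow by lia.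
  rewrite minus_INR, plus_INR, RtoC_minus, RtoC_plus by lia. field.
- intros j _. unfold ker. rewrite Cpow_add_r.
  replace (Cpow (zeta j) k) with (zeta j ^ (k - n) * zeta j ^ n)%C
   by (rewrite <- Cpow_add_r; f_equal; lia).
  generalize (wt j) (zeta_neq_0 j). intros W Hz. field. apply Cpow_nz, Hz.
Qed.

End RootAverages.

Lemma sum_n_R_mult_l (c : R) (u : nat -> R) (m : nat) :
  sum_n (fun k => c * u k) m = c * sum_n u m.
Proof. exact (@sum_n_mult_l R_Ring c u m). Qed.

Lemma sum_n_R_le (u v : nat -> R) (m : nat) :
  (forall k, u k <= v k) -> sum_n u m <= sum_n v m.
Proof. intros H. apply sum_n_m_le, H. Qed.

(** The polynomial is averaged against the kernel over the roots of -1. The slack [tau] is there for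
    truncations of a power series, whose real part is only nearly nonnegative. *)
Lemma boundary_inequality_poly (b : nat -> C) (M n : nat) (lambda : C) (tau : R) :
  (1 <= n)%nat -> (forall k, (k < n)%nat -> b k = RtoC 0) ->
  Cmod lambda = 1 -> 0 <= tau ->
  (forall zeta, Cmod zeta = 1 -> - tau <= Re (sum_n (fun k => (b k * (zeta ^ k - 1))%C) M)) ->
  - (INR (M + n) * tau) <=
    (Re lambda - 1) * Re (sum_n (fun k => (INR k * b k)%C) M)
    - INR n * Re (lambda * sum_n b M)%C.
Proof.
intros Hn Hb Hl Ht H.
(* The number of nodes is N = M + n, just enough for k + n <= N to hold for every k <= M. *)
destruct (M + n)%nat as [|m] eqn:Em; [lia|].
destruct (roots_of_minus_one m) as [zeta [Hz Hs]].
assert (Hz1 := fun j => proj1 (Hz j)). assert (Hz2 := fun j => proj2 (Hz j)).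
set (ker j := ((2 - lambda / zeta j ^ n - Cconj lambda * zeta j ^ n) *
   (/ ((1 - zeta j) * (1 - / zeta j))))%C).
set (P j := sum_n (fun k => (b k * (zeta j ^ k - 1))%C) M).
set (rhs := _ - _).
assert (HN : 0 < INR (S m)) by (apply lt_0_INR; lia).
assert (E : Re (sum_n (fun j => (ker j * P j)%C) m) = INR (S m) * rhs).
{ rewrite (sum_n_C_ext _ (fun j => sum_n (fun k => (b k * ((zeta j ^ k - 1) * ker j))%C) M)).
  2:{ intros j _. unfold P. rewrite <- sum_n_C_mult_l. apply sum_n_C_ext. intros k _. ring. }
  rewrite sum_n_switch.
  (* Index k contributes N ((Re lambda - 1) k - n lambda) b_k up to an exchange of sums: trivially
     for k < n, where b_k = 0, and by [sum_ker_pow] otherwise. *)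
  rewrite (sum_n_C_ext _ (fun k => (INR (S m) * ((RtoC (Re lambda) - 1) * (INR k * b k) + (- INR n * lambda) * b k))%C)).
  - rewrite sum_n_C_mult_l, sum_n_C_plus, !sum_n_C_mult_l. unfold rhs.
    generalize (sum_n (fun k : nat => (INR k * b k)%C) M) (sum_n b M).
    intros [x1 y1] [x2 y2]. destruct lambda as [l1 l2]. simpl. ring.
  - intros k Hk. rewrite sum_n_C_mult_l.
    destruct (Nat.lt_ge_cases k n) as [Hkn|Hkn]; [rewrite Hb by exact Hkn; ring|].
    unfold ker. rewrite (sum_ker_pow m zeta Hz1 Hz2 Hs n lambda k Hkn) by lia.
    rewrite re_alt. field. }
assert (Hker : forall j, - tau * (4 * Re (/ ((1 - zeta j) * (1 - / zeta j)))%C) <= Re (ker j * P j)%C).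
{ intros j. destruct (ker_bounds m zeta Hz1 Hz2 n lambda Hl j) as [r [Er Hr]].
  unfold ker. rewrite Er.
  replace (Re (r * P j)%C) with (r * Re (P j)) by (destruct (P j); simpl; ring).
  assert (HP := H (zeta j) (Hz1 j)). fold (P j) in HP.
  replace (Re (4 * _)%C) with (4 * Re (/ ((1 - zeta j) * (1 - / zeta j)))%C) in Hr.
  - nra.
  - generalize (/ ((1 - zeta j) * (1 - / zeta j)))%C. intros [x y]; simpl; ring. }
(* The weights add up to N^2/4, so the total error is tau N^2; dividing by N leaves (M + n) tau. *)
apply sum_n_R_le with (m := m) in Hker.
rewrite !sum_n_R_mult_l, <- !Re_sum_n in Hker.
rewrite (sum_wt m zeta Hz1 Hz2 Hs) in Hker. rewrite E in Hker.
replace (Re (INR (S m) * INR (S m) / 4)%C) with (INR (S m) * INR (S m) / 4) in Hker.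
- nra.
- rewrite <- RtoC_mult, <- RtoC_div by lra. reflexivity.
Qed.

(** * Series of complex numbers and passage to the limit *)

Lemma Cmod_le_abs (z : C) : Cmod z <= Rabs (Re z) + Rabs (Im z).
Proof.
destruct z as [x y]. unfold Cmod, Re, Im; simpl fst; simpl snd.
assert (Hx := Rabs_pos x). assert (Hy := Rabs_pos y).
rewrite <- (pow2_abs x), <- (pow2_abs y).
rewrite <- (sqrt_pow2 (Rabs x + Rabs y)) by lra.
apply sqrt_le_1_alt. nra.
Qed.

Lemma Cmod_sum_n_le (a : nat -> C) (N : nat) :
  Cmod (sum_n a N) <= sum_n (fun k => Cmod (a k)) N.
Proof. exact (norm_sum_n_m a 0 N). Qed.

Lemma is_series_Re (a : nat -> C) (l : C) :
  is_series a l -> is_series (fun k => Re (a k)) (Re l).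
Proof.
intros H. apply filterlim_ext with (fun N => Re (sum_n a N)).
- intros N. apply Re_sum_n.
- apply (filterlim_comp _ _ _ (fun N => sum_n a N) (fun z : C => Re z) _ (locally l)).
  + exact H.
  + destruct l as [x y]. exact (continuous_fst x y).
Qed.

Lemma is_series_Im (a : nat -> C) (l : C) :
  is_series a l -> is_series (fun k => Im (a k)) (Im l).
Proof.
intros H. apply filterlim_ext with (fun N => Im (sum_n a N)).
- intros N. induction N as [|N IH]; [now rewrite !sum_O|].
  now rewrite sum_n_C_S, sum_Sn, <- IH.
- apply (filterlim_comp _ _ _ (fun N => sum_n a N) (fun z : C => Im z) _ (locally l)).
  + exact H.
  + destruct l as [x y]. exact (continuous_snd x y).
Qed.

Lemma is_series_C_unique (a : nat -> C) (l1 l2 : C) :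
  is_series a l1 -> is_series a l2 -> l1 = l2.
Proof.
intros H1 H2.
assert (R1 := is_series_unique _ _ (is_series_Re _ _ H1)).
assert (R2 := is_series_unique _ _ (is_series_Re _ _ H2)).
assert (I1 := is_series_unique _ _ (is_series_Im _ _ H1)).
assert (I2 := is_series_unique _ _ (is_series_Im _ _ H2)).
destruct l1, l2; simpl in *. congruence.
Qed.

(** Summing real and imaginary parts separately gives a total function; it is the sum of the series
    whenever that converges. *)
Definition CSeries (a : nat -> C) : C :=
  (Series (fun k => Re (a k)), Series (fun k => Im (a k))).

Lemma CSeries_unique (a : nat -> C) (l : C) : is_series a l -> CSeries a = l.
Proof.
intros H. unfold CSeries.
rewrite (is_series_unique _ _ (is_series_Re _ _ H)), (is_series_unique _ _ (is_series_Im _ _ H)).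
now destruct l.
Qed.

Lemma CSeries_correct (a : nat -> C) :
  ex_series (fun k => Cmod (a k)) -> is_series a (CSeries a).
Proof.
intros H.
assert (E : ex_series a).
{ apply (@ex_series_le C_AbsRing C_CompleteNormedModule) with (2 := H). intros k. apply Rle_refl. }
destruct E as [l Hl]. now rewrite (CSeries_unique a l Hl).
Qed.

Lemma Cmod_series_le (a : nat -> C) (l : C) :
  is_series a l -> ex_series (fun k => Cmod (a k)) -> Cmod l <= Series (fun k => Cmod (a k)).
Proof.
intros H He.
assert (L1 : is_lim_seq (fun N => Cmod (sum_n a N)) (Cmod l)).
{ apply (filterlim_comp _ _ _ (fun N => sum_n a N) (fun z : C => Cmod z) _ (locally l)).
  - exact H.
  - exact (@filterlim_norm C_AbsRing C_NormedModule l). }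
apply (is_lim_seq_le _ _ (Cmod l) (Series (fun k => Cmod (a k))) (Cmod_sum_n_le a) L1).
exact (Series_correct _ He).
Qed.

Lemma is_series_C_scal (c : C) (a : nat -> C) (l : C) :
  is_series a l -> is_series (fun k => (c * a k)%C) (c * l)%C.
Proof. exact (@is_series_scal C_AbsRing C_NormedModule c a l). Qed.

Lemma is_series_C_minus (a b : nat -> C) (la lb : C) :
  is_series a la -> is_series b lb -> is_series (fun k => (a k - b k)%C) (la - lb)%C.
Proof. exact (@is_series_minus C_AbsRing C_NormedModule a b la lb). Qed.

Lemma is_series_C_ext (a b : nat -> C) (l : C) :
  (forall k, a k = b k) -> is_series a l -> is_series b l.
Proof. exact (@is_series_ext C_AbsRing C_NormedModule a b l). Qed.

Lemma is_series_C_tail (a : nat -> C) (l : C) (M : nat) :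
  is_series a l -> is_series (fun k => a (S M + k)%nat) (l - sum_n a M)%C.
Proof.
intros H. apply (@is_series_incr_n C_AbsRing C_NormedModule a (S M)); [lia|].
simpl pred. replace (plus _ _) with l; [exact H|].
change (l = (l - sum_n a M + sum_n a M)%C). ring.
Qed.

Lemma is_series_C_cons (a : nat -> C) (l : C) :
  is_series (fun k => a (S k)) l -> is_series a (a 0%nat + l)%C.
Proof.
intros H. apply (@is_series_decr_1 C_AbsRing C_NormedModule).
change (is_series (fun k => a (S k)) (a 0%nat + l - a 0%nat)%C).
replace (a 0%nat + l - a 0%nat)%C with l by ring. exact H.
Qed.

Lemma is_lim_seq_Series_tail (u : nat -> R) :
  ex_series u -> is_lim_seq (fun M => Series (fun k => u (S M + k)%nat)) 0.
Proof.
intros H.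
apply is_lim_seq_ext with (fun M => Series u - sum_n u M).
- intros M. rewrite (Series_incr_n u (S M)) by (lia || exact H).
  simpl pred. rewrite <- sum_n_Reals. ring.
- replace 0 with (Series u - Series u) by ring.
  apply is_lim_seq_minus'; [apply is_lim_seq_const | exact (Series_correct _ H)].
Qed.

Lemma Series_ge_0 (u : nat -> R) :
  (forall k, 0 <= u k) -> ex_series u -> 0 <= Series u.
Proof.
intros H Hu. rewrite <- (Rmult_0_l (Series u)), <- Series_scal_l.
apply Series_le; [|exact Hu]. intros k. rewrite Rmult_0_l. split; [lra | apply H].
Qed.

(** This is the limit of [boundary_inequality_poly] as M grows. The slack for the partial sum up to
    M is 2 T(M)/(M+1), with T(M) the tail of the series of k |b_k|; the factor 1/(M+1) pays for the
    M + n nodes, and T(M) tends to 0. *)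
Lemma boundary_inequality (b : nat -> C) (n : nat) (lambda B W : C) :
  (1 <= n)%nat -> (forall k, (k < n)%nat -> b k = RtoC 0) -> Cmod lambda = 1 ->
  ex_series (fun k => INR k * Cmod (b k)) ->
  is_series b B -> is_series (fun k => (INR k * b k)%C) W ->
  (forall zeta l, Cmod zeta = 1 -> is_series (fun k => (b k * (zeta ^ k - 1))%C) l -> 0 <= Re l) ->
  0 <= (Re lambda - 1) * Re W - INR n * Re (lambda * B)%C.
Proof.
intros Hn Hb Hl Hsum HB HW Hpos.
set (T M := Series (fun k => INR (S M + k) * Cmod (b (S M + k)%nat))).
assert (HT0 : forall M, 0 <= T M).
{ intros M. apply Series_ge_0.
  - intros k. apply Rmult_le_pos; [apply pos_INR | apply Cmod_ge_0].
  - apply (ex_series_incr_n (fun k => INR k * Cmod (b k)) (S M)), Hsum. }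
assert (Hineq : forall M, - (2 * INR n * T M) <=
    (Re lambda - 1) * Re (sum_n (fun k => (INR k * b k)%C) M)
    - INR n * Re (lambda * sum_n b M)%C).
{ intros M.
  assert (HM : 0 < INR (S M)) by (apply lt_0_INR; lia).
  apply Rle_trans with (- (INR (M + n) * (2 * T M / INR (S M)))).
  - assert (Hle : INR (M + n) <= INR n * INR (S M)).
    { rewrite <- mult_INR. apply le_INR. nia. }
    replace (2 * INR n * T M) with (INR n * INR (S M) * (2 * T M / INR (S M))) by (field; lra).
    apply Ropp_le_contravar, Rmult_le_compat_r; [|exact Hle].
    apply Rdiv_le_0_compat; [specialize (HT0 M); lra | exact HM].
  - apply boundary_inequality_poly; try assumption.
    { apply Rdiv_le_0_compat; [specialize (HT0 M); lra | exact HM]. }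
    intros zeta Hz.
    (* Tail indices k are at least M + 1, so |zeta^k - 1| <= 2 <= 2k/(M+1). *)
    assert (Hterm : forall k, Cmod (b (S M + k)%nat * (zeta ^ (S M + k) - 1))%C
              <= 2 / INR (S M) * (INR (S M + k) * Cmod (b (S M + k)%nat))).
    { intros k. rewrite Cmod_mult.
      assert (H2 : Cmod (zeta ^ (S M + k) - 1)%C <= 2).
      { eapply Rle_trans; [apply Cmod_triangle|].
        rewrite Cmod_opp, Cmod_pow, Hz, pow1, Cmod_1. lra. }
      assert (Hk : 1 <= / INR (S M) * INR (S M + k)).
      { apply Rmult_le_reg_l with (INR (S M)); [exact HM|].
        rewrite <- Rmult_assoc, Rinv_r, Rmult_1_l, Rmult_1_r by lra.
        apply le_INR. lia. }
      assert (H0 := Cmod_ge_0 (b (S M + k)%nat)).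
      assert (H3 := Cmod_ge_0 (zeta ^ (S M + k) - 1)%C).
      unfold Rdiv. nra. }
    assert (Hex : ex_series (fun k => 2 / INR (S M) * (INR (S M + k) * Cmod (b (S M + k)%nat)))).
    { apply (@ex_series_scal R_AbsRing R_NormedModule (2 / INR (S M))
        (fun k => INR (S M + k) * Cmod (b (S M + k)%nat))).
      apply (ex_series_incr_n (fun k => INR k * Cmod (b k)) (S M)), Hsum. }
    assert (Hex' : ex_series (fun k => Cmod (b (S M + k)%nat * (zeta ^ (S M + k) - 1))%C)).
    { apply (ex_series_le (V := R_CompleteNormedModule)) with (2 := Hex).
      intros k. change (Rabs (Cmod (b (S M + k)%nat * (zeta ^ (S M + k) - 1))%C) <= 2 / INR (S M) * (INR (S M + k) * Cmod (b (S M + k)%nat))).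
      rewrite Rabs_pos_eq by apply Cmod_ge_0. apply Hterm. }
    set (c k := (b k * (zeta ^ k - 1))%C) in *.
    assert (Hc : is_series c (CSeries c)).
    { apply CSeries_correct. apply (ex_series_incr_n _ (S M)). exact Hex'. }
    assert (H0 := Hpos zeta _ Hz Hc).
    assert (Ht := is_series_C_tail _ _ M Hc).
    assert (Hle := Cmod_series_le _ _ Ht Hex').
    assert (Hle2 := Series_le _ _ (fun k => conj (Cmod_ge_0 _) (Hterm k)) Hex).
    rewrite Series_scal_l in Hle2. fold (T M) in Hle2.
    assert (Hre := re_le_Cmod (CSeries c - sum_n c M)%C).
    apply Rabs_le_between in Hre.
    replace (Re (CSeries c - sum_n c M)%C) with (Re (CSeries c) - Re (sum_n c M)) in Hre
      by (simpl; ring).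
    replace (2 * T M / INR (S M)) with (2 / INR (S M) * T M) by (field; lra).
    (* The whole series has nonnegative real part, so the partial sum falls below 0 by at most the
       modulus of the tail. *)
    apply Rle_trans with (- Cmod (CSeries c - sum_n c M)%C).
    { apply Ropp_le_contravar. exact (Rle_trans _ _ _ Hle Hle2). }
    apply proj2 in Hre. clear - H0 Hre. lra. }
assert (L1 : is_lim_seq (fun M => - (2 * INR n * T M)) (- (2 * INR n * 0))).
{ apply (proj1 (is_lim_seq_opp _ (Finite _))). apply is_lim_seq_mult'; [apply is_lim_seq_const|].
  exact (is_lim_seq_Series_tail (fun k => INR k * Cmod (b k)) Hsum). }
assert (L2 : is_lim_seq (fun M => (Re lambda - 1) * Re (sum_n (fun k => (INR k * b k)%C) M)
    - INR n * Re (lambda * sum_n b M)%C) ((Re lambda - 1) * Re W - INR n * Re (lambda * B)%C)).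
{ apply is_lim_seq_minus'; (apply is_lim_seq_mult'; [apply is_lim_seq_const|]).
  - eapply is_lim_seq_ext; [|exact (is_series_Re _ _ HW)].
    intros M. symmetry. apply Re_sum_n.
  - eapply is_lim_seq_ext; [|exact (is_series_Re _ _ (is_series_C_scal lambda _ _ HB))].
    intros M. rewrite <- sum_n_C_mult_l. symmetry. apply Re_sum_n. }
assert (H := is_lim_seq_le _ _ _ _ Hineq L1 L2). simpl in H. rewrite Rmult_0_r, Ropp_0 in H. exact H.
Qed.

(** * Complex power series *)

(** Phrased with moduli so that the real theory of [CV_radius] applies; convergence inside the unit
    disk is then absolute. *)
Definition radius_ge_1 (a : nat -> C) : Prop :=
  Rbar_le 1 (CV_radius (fun k => Cmod (a k))).

Definition CPSeries (a : nat -> C) (z : C) : C := CSeries (fun k => (a k * z ^ k)%C).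

Definition CPS_derive (a : nat -> C) (k : nat) : C := (INR (S k) * a (S k))%C.

Lemma radius_ge_1_abs_summable (a : nat -> C) (rho : R) :
  radius_ge_1 a -> 0 <= rho < 1 -> ex_series (fun k => Cmod (a k) * rho ^ k).
Proof.
intros Ha Hr.
apply ex_series_ext with (fun k => Rabs (Cmod (a k) * rho ^ k)).
- intros k. apply Rabs_pos_eq, Rmult_le_pos; [apply Cmod_ge_0 | apply pow_le; lra].
- apply CV_disk_inside. apply Rbar_lt_le_trans with 1; [|exact Ha].
  simpl. rewrite Rabs_pos_eq; lra.
Qed.

Lemma radius_ge_1_derive (a : nat -> C) : radius_ge_1 a -> radius_ge_1 (CPS_derive a).
Proof.
intros Ha. unfold radius_ge_1 in *. rewrite <- CV_radius_derive in Ha.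
rewrite (CV_radius_ext _ (PS_derive (fun k => Cmod (a k)))); [exact Ha|].
intros k. unfold CPS_derive, PS_derive.
rewrite Cmod_mult, Cmod_R, Rabs_pos_eq by apply pos_INR. reflexivity.
Qed.

Lemma radius_ge_1_shift (a : nat -> C) (m : nat) :
  radius_ge_1 a -> radius_ge_1 (fun k => a (m + k)%nat).
Proof.
intros Ha. induction m as [|m IH]; [exact Ha|].
unfold radius_ge_1 in *. rewrite <- CV_radius_decr_1 in IH.
rewrite (CV_radius_ext _ (PS_decr_1 (fun k => Cmod (a (m + k)%nat)))); [exact IH|].
intros k. unfold PS_decr_1. do 2 f_equal. lia.
Qed.

Lemma radius_ge_1_scal (c : C) (a : nat -> C) :
  c <> RtoC 0 -> radius_ge_1 a -> radius_ge_1 (fun k => (c * a k)%C).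
Proof.
intros Hc Ha. unfold radius_ge_1.
rewrite (CV_radius_ext _ (PS_scal (Cmod c) (fun k => Cmod (a k)))).
- rewrite CV_radius_scal; [exact Ha|]. apply Rgt_not_eq, Cmod_gt_0, Hc.
- intros k. apply Cmod_mult.
Qed.

Lemma pow_n_Cpow (z : C) (k : nat) : pow_n z k = Cpow z k.
Proof. induction k as [|k IH]; [reflexivity|]. simpl. rewrite IH. reflexivity. Qed.

(** Convergence at a real point r < 1 bounds the terms |a_k| r^k, so the radius is at least r; then
    r is let tend to 1. *)
Lemma is_pseries_disk_radius (a : nat -> C) (f : C -> C) :
  (forall z, Cmod z < 1 -> @is_pseries C_AbsRing C_NormedModule a z (f z)) -> radius_ge_1 a.
Proof.
intros H. unfold radius_ge_1.
assert (Hr : forall r, 0 <= r < 1 -> Rbar_le r (CV_radius (fun k => Cmod (a k)))).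
{ intros r Hr.
  apply (proj1 (CV_radius_bounded _)).
  assert (Hs := H (RtoC r)). rewrite Cmod_R, Rabs_pos_eq in Hs by lra.
  specialize (Hs (proj2 Hr)).
  destruct (filterlim_bounded (fun k => Re (scal (pow_n (RtoC r) k) (a k)))) as [M HM].
  { exists 0. apply ex_series_lim_0. exists (Re (f r)). apply is_series_Re, Hs. }
  destruct (filterlim_bounded (fun k => Im (scal (pow_n (RtoC r) k) (a k)))) as [M' HM'].
  { exists 0. apply ex_series_lim_0. exists (Im (f r)). apply is_series_Im, Hs. }
  exists (M + M'). intros k.
  rewrite Rabs_pos_eq by (apply Rmult_le_pos; [apply Cmod_ge_0 | apply pow_le; lra]).
  specialize (HM k). specialize (HM' k).
  rewrite pow_n_Cpow, <- RtoC_pow in HM, HM'.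
  change (Rabs (Re (RtoC (r ^ k) * a k)%C) <= M) in HM.
  change (Rabs (Im (RtoC (r ^ k) * a k)%C) <= M') in HM'.
  replace (Cmod (a k) * r ^ k) with (Cmod (RtoC (r ^ k) * a k)%C).
  - eapply Rle_trans; [|exact (Rplus_le_compat _ _ _ _ HM HM')].
    apply Cmod_le_abs.
  - rewrite Cmod_mult, Cmod_R, Rabs_pos_eq by (apply pow_le; lra). ring. }
destruct (CV_radius (fun k => Cmod (a k))) as [x| |]; simpl in *; [|trivial|].
(* A radius x < 1 is refuted by r = (1 + x)/2; the value r = 0 first gives x >= 0, which makes that
   r admissible. *)
- apply Rnot_lt_le. intros Hx.
  assert (H0 := Hr 0 ltac:(lra)). assert (H1 := Hr ((1 + x) / 2) ltac:(lra)). lra.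
- apply (Hr 0). lra.
Qed.

Lemma CPSeries_correct (a : nat -> C) (z : C) :
  radius_ge_1 a -> Cmod z < 1 -> is_series (fun k => (a k * z ^ k)%C) (CPSeries a z).
Proof.
intros Ha Hz. apply CSeries_correct.
apply ex_series_ext with (fun k => Cmod (a k) * Cmod z ^ k).
- intros k. now rewrite Cmod_mult, Cmod_pow.
- apply radius_ge_1_abs_summable; [exact Ha|]. split; [apply Cmod_ge_0 | exact Hz].
Qed.

Lemma CPSeries_unique (a : nat -> C) (z l : C) :
  @is_pseries C_AbsRing C_NormedModule a z l -> CPSeries a z = l.
Proof.
intros H. apply CSeries_unique.
apply is_series_C_ext with (2 := H). intros k. rewrite pow_n_Cpow. apply Cmult_comm.
Qed.

(** Induction on k: the next remainder is w times the previous one plus (k+1) z^k (w - z)^2. The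
    truncated [k - 1] at k = 0 is harmless, since the factor [INR k] vanishes there. *)
Lemma pow_taylor_remainder (z w : C) (rho : R) (k : nat) :
  Cmod z <= rho -> Cmod w <= rho ->
  Cmod (w ^ S k - z ^ S k - INR (S k) * z ^ k * (w - z))%C
    <= INR (S k) * INR k * rho ^ (k - 1) * Cmod (w - z) ^ 2.
Proof.
intros Hz Hw. assert (Hz0 := Cmod_ge_0 z). assert (Hw0 := Cmod_ge_0 w).
assert (Hd := Cmod_ge_0 (w - z)%C).
induction k as [|k IH].
- replace (_ - _)%C with (RtoC 0) by (simpl; ring). rewrite Cmod_0. simpl. lra.
- replace (w ^ S (S k) - z ^ S (S k) - INR (S (S k)) * z ^ S k * (w - z))%C
    with (w * (w ^ S k - z ^ S k - INR (S k) * z ^ k * (w - z)) + INR (S k) * z ^ k * ((w - z) * (w - z)))%C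
    by (rewrite (S_INR (S k)), RtoC_plus, !Cpow_S; ring).
  eapply Rle_trans; [apply Cmod_triangle|].
  rewrite !Cmod_mult, Cmod_R, Cmod_pow, Rabs_pos_eq by apply pos_INR.
  set (d := Cmod (w - z)%C) in *. set (E := Cmod (w ^ S k - z ^ S k - INR (S k) * z ^ k * (w - z))%C) in *.
  assert (HE : 0 <= E) by apply Cmod_ge_0.
  assert (Hk := pos_INR k). rewrite !S_INR in *.
  assert (Hp : 0 <= rho ^ k) by (apply pow_le; lra).
  assert (Hzk : Cmod z ^ k <= rho ^ k) by (apply pow_incr; lra).
  assert (H1 : Cmod w * E <= (INR k + 1) * INR k * rho ^ k * d ^ 2).
  { apply Rle_trans with (rho * ((INR k + 1) * INR k * rho ^ (k - 1) * d ^ 2)).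
    - apply Rmult_le_compat; assumption.
    - destruct k as [|k]; [simpl; lra|].
      replace (S k - 1)%nat with k by lia. change (rho ^ S k) with (rho * rho ^ k). apply Req_le; ring. }
  assert (H2 : (INR k + 1) * Cmod z ^ k * (d * d) <= (INR k + 1) * rho ^ k * d ^ 2).
  { replace (d ^ 2) with (d * d) by ring.
    apply Rmult_le_compat_r; [nra|]. apply Rmult_le_compat_l; lra. }
  replace (S k - 1)%nat with k by lia.
  assert (H3 : 0 <= rho ^ k * d ^ 2) by (apply Rmult_le_pos; [exact Hp | apply pow_le, Hd]).
  nra.
Qed.

(** Termwise sum of [pow_taylor_remainder]: K is the second derivative of the series of |a_k| x^k at
    x = rho. This uniform estimate yields differentiability, the Lipschitz bound, and the reality of
    W in Jack's lemma. *)
Lemma CPSeries_taylor (a : nat -> C) (rho : R) :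
  radius_ge_1 a -> 0 <= rho < 1 ->
  exists K, 0 <= K /\ forall z w, Cmod z <= rho -> Cmod w <= rho ->
    Cmod (CPSeries a w - CPSeries a z - CPSeries (CPS_derive a) z * (w - z))%C
      <= K * Cmod (w - z) ^ 2.
Proof.
intros Ha Hr.
set (u k := Cmod (a (S k)) * (INR (S k) * INR k * rho ^ (k - 1))).
assert (Hu : ex_series u).
(* Without its first term, the series of [u] is that of the twice differentiated coefficients. *)
{ apply ex_series_incr_1.
  apply ex_series_ext with (fun k => Cmod (CPS_derive (CPS_derive a) k) * rho ^ k).
  - intros k. unfold u, CPS_derive. rewrite !Cmod_mult, !Cmod_R, !Rabs_pos_eq by apply pos_INR.
    replace (S k - 1)%nat with k by lia.
    R_eq. ring.
  - apply radius_ge_1_abs_summable; [|exact Hr]. now apply radius_ge_1_derive, radius_ge_1_derive. }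
assert (Hu0 : forall k, 0 <= u k).
{ intros k. unfold u. assert (H0 := Cmod_ge_0 (a (S k))). assert (H1 := pos_INR k).
  assert (H2 := pos_INR (S k)). assert (H3 : 0 <= rho ^ (k - 1)) by (apply pow_le; lra).
  apply Rmult_le_pos; [exact H0|]. apply Rmult_le_pos; [|exact H3]. now apply Rmult_le_pos. }
exists (Series u). split; [now apply Series_ge_0|].
intros z w Hz Hw.
assert (S1 := CPSeries_correct a w Ha ltac:(lra)).
assert (S2 := CPSeries_correct a z Ha ltac:(lra)).
assert (S3 := CPSeries_correct _ z (radius_ge_1_derive a Ha) ltac:(lra)).
assert (Sd := is_series_C_tail _ _ 0 (is_series_C_minus _ _ _ _ S1 S2)).
assert (S4 := is_series_C_minus _ _ _ _ Sd (is_series_C_scal (w - z)%C _ _ S3)).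
set (t k := (a (S k) * (w ^ S k - z ^ S k - INR (S k) * z ^ k * (w - z)))%C).
assert (St : is_series t (CPSeries a w - CPSeries a z - CPSeries (CPS_derive a) z * (w - z))%C).
{ replace (_ - _)%C with
   (CPSeries a w - CPSeries a z - sum_n (fun k => (a k * w ^ k - a k * z ^ k)%C) 0 - (w - z) * CPSeries (CPS_derive a) z)%C.
  - apply is_series_C_ext with (2 := S4). intros k. unfold t, CPS_derive. change (1 + k)%nat with (S k). ring.
  - rewrite sum_O. simpl. ring. }
assert (Hb : forall k, 0 <= Cmod (t k) <= u k * Cmod (w - z) ^ 2).
{ intros k. split; [apply Cmod_ge_0|]. unfold t, u. rewrite Cmod_mult.
  rewrite Rmult_assoc. apply Rmult_le_compat_l; [apply Cmod_ge_0|].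
  now apply pow_taylor_remainder. }
assert (Hex : ex_series (fun k => u k * Cmod (w - z) ^ 2)) by now apply ex_series_scal_r.
assert (Hext : ex_series (fun k => Cmod (t k))).
{ apply (ex_series_le (V := R_CompleteNormedModule)) with (2 := Hex).
  intros k. change (Rabs (Cmod (t k)) <= u k * Cmod (w - z)%C ^ 2).
  rewrite Rabs_pos_eq; apply Hb. }
eapply Rle_trans; [exact (Cmod_series_le _ _ St Hext)|].
rewrite <- Series_scal_r. now apply Series_le.
Qed.

(** Two uniform structures on C occur: the variable of a derivative uses the balls of [Cmod],
    whereas [merom_value] uses product balls. [locally_C] passes between them. *)
Lemma locally_C_ball (z : C) (d : R) (P : C -> Prop) :
  0 < d -> (forall w, Cmod (w - z)%C < d -> P w) ->
  @locally (AbsRing_UniformSpace C_AbsRing) z P.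
Proof. intros Hd H. exists (mkposreal d Hd). exact H. Qed.

Lemma locally_disk (z : C) (P : C -> Prop) :
  Cmod z < 1 -> (forall w, Cmod w < 1 -> P w) ->
  @locally (AbsRing_UniformSpace C_AbsRing) z P.
Proof.
intros Hz H. apply locally_C_ball with (1 - Cmod z); [lra|].
intros w Hw. apply H. replace w with (z + (w - z))%C by ring.
eapply Rle_lt_trans; [apply Cmod_triangle|]. lra.
Qed.

Lemma is_derive_CPSeries (a : nat -> C) (z : C) :
  radius_ge_1 a -> Cmod z < 1 ->
  @is_derive C_AbsRing C_NormedModule (CPSeries a) z (CPSeries (CPS_derive a) z).
Proof.
intros Ha Hz. split; [apply is_linear_scal_l|].
intros x Hx. apply (@is_filter_lim_locally_unique C_AbsRing (AbsRing_NormedModule C_AbsRing)) in Hx.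
subst x.
assert (Hz0 := Cmod_ge_0 z).
destruct (CPSeries_taylor a ((1 + Cmod z) / 2) Ha ltac:(lra)) as [K [HK H]].
intros eps.
(* The first bound keeps w in the disk where the Taylor estimate holds, the second makes K |w - z|
   <= eps; K + 1 avoids a division by 0. *)
assert (Hd : 0 < Rmin ((1 - Cmod z) / 2) (eps / (K + 1))).
{ apply Rmin_glb_lt; [lra|]. apply Rdiv_lt_0_compat; [apply cond_pos | lra]. }
apply (locally_C_ball z _ _ Hd). intros w Hw.
assert (Hw1 := Rlt_le_trans _ _ _ Hw (Rmin_l _ _)).
assert (Hw2 := Rlt_le_trans _ _ _ Hw (Rmin_r _ _)).
assert (Hwm : Cmod w <= (1 + Cmod z) / 2).
{ replace w with (z + (w - z))%C by ring. eapply Rle_trans; [apply Cmod_triangle|]. lra. }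
specialize (H z w ltac:(lra) Hwm).
change (Cmod (CPSeries a w - CPSeries a z - (w - z) * CPSeries (CPS_derive a) z)%C <= eps * Cmod (w - z)%C).
rewrite (Cmult_comm (w - z)%C).
eapply Rle_trans; [exact H|]. replace (Cmod (w - z) ^ 2) with (Cmod (w - z) * Cmod (w - z)) by ring.
rewrite <- Rmult_assoc. apply Rmult_le_compat_r; [apply Cmod_ge_0|].
apply Rle_trans with ((K + 1) * (eps / (K + 1))).
- assert (H0 := Cmod_ge_0 (w - z)%C). apply Rmult_le_compat; lra.
- apply Req_le. field. lra.
Qed.

(** * Minima of the real part on circles *)

Definition lipschitz_on_disk (g : C -> R) (L rho : R) : Prop :=
  0 <= L /\ forall z w, Cmod z <= rho -> Cmod w <= rho -> Rabs (g w - g z) <= L * Cmod (w - z)%C.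

Lemma Cmod_half_circle (r s x : R) :
  0 <= r -> s * s = 1 -> - r <= x <= r -> Cmod (x, s * sqrt (r ^ 2 - x ^ 2)) = r.
Proof.
intros Hr Hs Hx. unfold Cmod; simpl fst; simpl snd.
replace (_ + _) with (r ^ 2); [apply sqrt_pow2, Hr|].
rewrite Rpow_mult_distr, pow2_sqrt by nra. nra.
Qed.

(** Parametrizing a half circle by the real part x, with s = 1 for the upper half and s = -1 for the
    lower one, reduces compactness to the extreme value theorem on [-r, r]. *)
Lemma half_circle_min (g : C -> R) (L r s : R) :
  0 <= r -> s * s = 1 -> lipschitz_on_disk g L r ->
  exists x0, - r <= x0 <= r /\ forall x, - r <= x <= r ->
    g (x0, s * sqrt (r ^ 2 - x0 ^ 2)) <= g (x, s * sqrt (r ^ 2 - x ^ 2)).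
Proof.
intros Hr Hs [HL Hg].
(* The extreme value theorem asks for two-sided continuity at the endpoints too, hence the clipping
   to [-r, r]. *)
set (clip x := Rmax (- r) (Rmin r x)).
assert (Hclip : forall x, - r <= clip x <= r).
{ intros x. unfold clip, Rmax, Rmin. repeat destruct Rle_dec; lra. }
assert (Eclip : forall x, - r <= x <= r -> clip x = x).
{ intros x Hx. unfold clip, Rmax, Rmin. repeat destruct Rle_dec; lra. }
assert (Cclip : forall x y, Rabs (clip y - clip x) <= Rabs (y - x)).
{ intros x y. unfold clip, Rmax, Rmin. repeat destruct Rle_dec; unfold Rabs; repeat destruct Rcase_abs; lra. }
set (y x := s * sqrt (r ^ 2 - clip x ^ 2)).
assert (Cc : forall x, continuity_pt clip x).
{ intros x. apply continuity_pt_filterlim, filterlim_locally. intros eps.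
  exists eps. intros t Ht. eapply Rle_lt_trans; [apply Cclip | exact Ht]. }
assert (Cy : forall x, continuity_pt y x).
{ intros x. apply continuity_pt_scal.
  apply (continuity_pt_comp (fun x => r ^ 2 - clip x ^ 2) sqrt).
  - apply continuity_pt_minus; [apply continuity_pt_const; intros ? ?; reflexivity|].
    apply (continuity_pt_comp clip (fun x => x ^ 2)); [apply Cc|].
    apply derivable_continuous_pt, derivable_pt_pow.
  - apply continuity_pt_sqrt. specialize (Hclip x). nra. }
assert (Cg : forall x, continuity_pt (fun x => g (clip x, y x)) x).
{ intros x. apply continuity_pt_filterlim, filterlim_locally. intros eps.
  assert (He : 0 < eps / (2 * (L + 1))) by (apply Rdiv_lt_0_compat; [apply cond_pos | lra]).
  assert (H1 := proj1 (filterlim_locally _ _) (proj1 (continuity_pt_filterlim _ _) (Cc x)) (mkposreal _ He)).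
  assert (H2 := proj1 (filterlim_locally _ _) (proj1 (continuity_pt_filterlim _ _) (Cy x)) (mkposreal _ He)).
  generalize (filter_and _ _ H1 H2). apply filter_imp. intros t [Ht1 Ht2].
  change (Rabs (clip t - clip x) < eps / (2 * (L + 1))) in Ht1.
  change (Rabs (y t - y x) < eps / (2 * (L + 1))) in Ht2.
  change (Rabs (g (clip t, y t) - g (clip x, y x)) < eps).
  assert (Hl := Hg (clip x, y x) (clip t, y t)).
  unfold y in Hl. rewrite !Cmod_half_circle in Hl by (assumption || apply Hclip).
  specialize (Hl (Rle_refl _) (Rle_refl _)). fold (y x) (y t) in Hl.
  assert (Hm := Cmod_le_abs ((clip t, y t) - (clip x, y x))%C).
  change (Re ((clip t, y t) - (clip x, y x))%C) with (clip t - clip x) in Hm.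
  change (Im ((clip t, y t) - (clip x, y x))%C) with (y t - y x) in Hm.
  set (d := Cmod _) in *.
  assert (Hd0 : 0 <= d) by apply Cmod_ge_0.
  assert (Hd : d < eps / (L + 1)).
  { replace (eps / (L + 1)) with (eps / (2 * (L + 1)) + eps / (2 * (L + 1))) by (field; lra). lra. }
  eapply Rle_lt_trans; [exact Hl|].
  replace (pos eps) with ((L + 1) * (eps / (L + 1))) by (field; lra).
  assert (L * d <= (L + 1) * d) by lra. assert ((L + 1) * d < (L + 1) * (eps / (L + 1))) by (apply Rmult_lt_compat_l; lra).
  lra. }
destruct (continuity_ab_min (fun x => g (clip x, y x)) (- r) r ltac:(lra) (fun c _ => Cg c)) as [x0 [H0 Hx0]].
exists x0. split; [exact Hx0|]. intros x Hx. specialize (H0 x Hx).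
unfold y in H0. rewrite !Eclip in H0 by assumption. exact H0.
Qed.

Lemma circle_min (g : C -> R) (L r : R) :
  0 <= r -> lipschitz_on_disk g L r ->
  exists z0, Cmod z0 = r /\ forall z, Cmod z = r -> g z0 <= g z.
Proof.
intros Hr Hg.
destruct (half_circle_min g L r 1 Hr ltac:(ring) Hg) as [x1 [Hx1 H1]].
destruct (half_circle_min g L r (-1) Hr ltac:(ring) Hg) as [x2 [Hx2 H2]].
assert (Hpt : forall z, Cmod z = r -> exists x, - r <= x <= r /\
   (z = (x, 1 * sqrt (r ^ 2 - x ^ 2)) \/ z = (x, -1 * sqrt (r ^ 2 - x ^ 2)))).
{ intros z Hz. assert (Hre := re_le_Cmod z). assert (E := Cmod2_alt z). rewrite Hz in *.
  destruct z as [x y]. simpl Re in *. simpl Im in *. exists x. split; [now apply Rabs_le_between|].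
  replace (r ^ 2 - x ^ 2) with (y ^ 2) by lra.
  destruct (Rle_dec 0 y); [left; rewrite sqrt_pow2 by lra | right; rewrite <- Rsqr_pow2, sqrt_Rsqr_abs, Rabs_left by lra];
  f_equal; ring. }
destruct (Rle_dec (g (x1, 1 * sqrt (r ^ 2 - x1 ^ 2))) (g (x2, -1 * sqrt (r ^ 2 - x2 ^ 2)))) as [Hle|Hle].
- exists (x1, 1 * sqrt (r ^ 2 - x1 ^ 2)). split; [apply Cmod_half_circle; lra|].
  intros z Hz. destruct (Hpt z Hz) as [x [Hx [-> | ->]]]; [now apply H1|].
  apply Rle_trans with (1 := Hle). now apply H2.
- exists (x2, -1 * sqrt (r ^ 2 - x2 ^ 2)). split; [apply Cmod_half_circle; lra|].
  intros z Hz. destruct (Hpt z Hz) as [x [Hx [-> | ->]]]; [|now apply H2].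
  apply Rle_trans with (g (x1, 1 * sqrt (r ^ 2 - x1 ^ 2))); [lra|]. now apply H1.
Qed.

(** Let r be the supremum of the t <= |z1| with g > gamma on |z| <= t. By continuity g >= gamma on
    |z| <= r. The point z0 minimizes g on |z| = r, and g z0 > gamma would allow a larger r. *)
Lemma first_crossing (g : C -> R) (L rho gamma : R) (z1 : C) :
  lipschitz_on_disk g L rho -> gamma < g (RtoC 0) -> Cmod z1 <= rho -> g z1 <= gamma ->
  exists z0, Cmod z0 <= rho /\ g z0 = gamma /\ forall z, Cmod z <= Cmod z0 -> gamma <= g z.
Proof.
intros [HL Hg] H0 Hz1 Hgz1. assert (Hz10 := Cmod_ge_0 z1).
set (E t := 0 <= t <= Cmod z1 /\ forall z, Cmod z <= t -> gamma < g z).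
assert (E0 : E 0).
{ split; [lra|]. intros z Hz. assert (Hz0 := Cmod_ge_0 z).
  rewrite (Cmod_eq_0 z) by lra. exact H0. }
destruct (completeness E) as [r [Hub Hlub]].
{ exists (Cmod z1). intros t [Ht _]. lra. }
{ exists 0. exact E0. }
assert (Hr0 : 0 <= r) by now apply Hub.
assert (Hr1 : r <= Cmod z1) by (apply Hlub; intros t [Ht _]; lra).
assert (Hin : forall z, Cmod z < r -> gamma < g z).
{ intros z Hz. apply Rnot_le_lt. intros Hle.
  apply (Rlt_not_le _ _ Hz), Hlub. intros t [Ht1 Ht2].
  apply Rnot_lt_le. intros Ht. specialize (Ht2 z ltac:(lra)). lra. }
destruct (circle_min g L r Hr0) as [z0 [Hz0 Hmin]].
{ split; [exact HL|]. intros z w Hz Hw. apply Hg; lra. }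
assert (Hscale : forall z s, 0 <= s -> Cmod (s * z)%C = s * Cmod z).
{ intros z s Hs. rewrite Cmod_mult, Cmod_R, Rabs_pos_eq; trivial. }
assert (Hge : forall z, Cmod z <= r -> gamma <= g z).
{ intros z Hz. apply Rnot_lt_le. intros Hlt.
  assert (Hzr : Cmod z = r).
  { apply Rle_antisym; [exact Hz|]. apply Rnot_lt_le. intros Hc. specialize (Hin z Hc). lra. }
  destruct (Req_dec r 0) as [Er|Er].
  { rewrite (Cmod_eq_0 z) in Hlt by lra. lra. }
  (* Shrinking z by the factor 1 - eps moves it into the open disk, where g > gamma, yet [eps] is
     too small for g to climb from g z to gamma. *)
  set (eps := Rmin 1 ((gamma - g z) / (L * r + 1))).
  assert (HLr : 0 < L * r + 1) by (assert (0 <= L * r) by (apply Rmult_le_pos; lra); lra).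
  assert (He0 : 0 < eps) by (apply Rmin_glb_lt; [lra | apply Rdiv_lt_0_compat; lra]).
  assert (He1 : eps <= 1) by apply Rmin_l.
  assert (He2 : eps * (L * r + 1) <= gamma - g z).
  { apply Rle_trans with ((gamma - g z) / (L * r + 1) * (L * r + 1)).
    - apply Rmult_le_compat_r; [lra | apply Rmin_r].
    - apply Req_le. field. lra. }
  assert (Hw : Cmod (RtoC (1 - eps) * z)%C = (1 - eps) * r) by (rewrite Hscale, Hzr; lra).
  assert (Hlt' : Cmod (RtoC (1 - eps) * z)%C < r) by (rewrite Hw; nra).
  specialize (Hin _ Hlt').
  assert (Hl := Hg z (RtoC (1 - eps) * z)%C ltac:(lra) ltac:(lra)).
  replace (Cmod (RtoC (1 - eps) * z - z)%C) with (eps * r) in Hl.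
  2:{ replace (RtoC (1 - eps) * z - z)%C with (- (RtoC eps * z))%C
        by (rewrite RtoC_minus; ring).
      rewrite Cmod_opp, Hscale, Hzr; lra. }
  apply Rabs_le_between in Hl. lra. }
exists z0. split; [lra|]. split; [|rewrite Hz0; exact Hge].
apply Rle_antisym; [|apply Hge; lra].
apply Rnot_lt_le. intros Hlt.
destruct (Req_dec r (Cmod z1)) as [Er|Er]; [specialize (Hmin z1 ltac:(lra)); lra|].
(* With this [eps] the Lipschitz bound keeps g above gamma on the ring r <= |z| <= r + eps, against
   the choice of r. *)
set (eps := Rmin (Cmod z1 - r) ((g z0 - gamma) / (L + 1))).
assert (He0 : 0 < eps) by (apply Rmin_glb_lt; [lra | apply Rdiv_lt_0_compat; lra]).
assert (He1 : eps <= Cmod z1 - r) by apply Rmin_l.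
assert (He2 : eps * (L + 1) <= g z0 - gamma).
{ apply Rle_trans with ((g z0 - gamma) / (L + 1) * (L + 1)).
  - apply Rmult_le_compat_r; [lra | apply Rmin_r].
  - apply Req_le. field. lra. }
assert (HE : E (r + eps)).
{ split; [lra|]. intros z Hz.
  destruct (Rlt_le_dec (Cmod z) r) as [Hzr|Hzr]; [now apply Hin|].
  destruct (Req_dec (Cmod z) 0) as [Ez|Ez].
  { rewrite (Cmod_eq_0 z Ez). exact H0. }
  assert (Hzp : 0 < Cmod z) by lra.
  (* Multiplication by [s] projects z radially to the circle of radius r. *)
  set (s := r / Cmod z).
  assert (Hs0 : 0 <= s) by (apply Rdiv_le_0_compat; lra).
  assert (Hsz : s * Cmod z = r) by (unfold s; field; lra).
  assert (Hw : Cmod (s * z)%C = r) by now rewrite Hscale.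
  assert (Hl := Hg (s * z)%C z ltac:(lra) ltac:(lra)).
  assert (Hs1 : s <= 1) by (apply Rmult_le_reg_r with (Cmod z); lra).
  replace (Cmod (z - s * z)%C) with (Cmod z - r) in Hl.
  2:{ replace (z - s * z)%C with (RtoC (1 - s) * z)%C by (rewrite RtoC_minus; ring).
      rewrite Hscale by lra. lra. }
  specialize (Hmin _ Hw). apply Rabs_le_between in Hl.
  assert (L * (Cmod z - r) <= L * eps) by (apply Rmult_le_compat_l; lra).
  lra. }
specialize (Hub _ HE). lra.
Qed.

(** For zeta = exp(i theta), Re (W (zeta - 1)) equals -theta Im W up to order theta^2. A quadratic
    lower bound for both signs of theta kills the linear term. *)
Lemma Im_eq_0_of_quadratic_bound (W : C) (K : R) :
  (forall zeta, Cmod zeta = 1 -> - (K * Cmod (zeta - 1)%C ^ 2) <= Re (W * (zeta - 1))%C) ->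
  Im W = 0.
Proof.
intros H. destruct W as [p q]. simpl Im.
assert (Ht : forall t, q * t <= (2 * K - p) * t ^ 2).
{ intros t. assert (Hp : 0 < 1 + t ^ 2) by nra.
  (* The parametrization (1 + it)/(1 - it) of the circle keeps everything rational, with |zeta -
     1|^2 = 4 t^2/(1 + t^2). *)
  pose (zeta := ((1 - t ^ 2) / (1 + t ^ 2), 2 * t / (1 + t ^ 2)) : C).
  assert (Hz : Cmod zeta = 1).
  { unfold Cmod, zeta; simpl fst; simpl snd. transitivity (sqrt 1); [f_equal; field; lra | exact sqrt_1]. }
  specialize (H zeta Hz). rewrite Cmod2_alt in H. unfold zeta in H.
  replace (Re _ ^ 2 + Im _ ^ 2) with (4 * t ^ 2 / (1 + t ^ 2)) in H by (simpl; field; lra).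
  replace (Re _) with ((- 2 * p * t ^ 2 - 2 * q * t) / (1 + t ^ 2)) in H by (simpl; field; lra).
  apply Rmult_le_compat_r with (r := 1 + t ^ 2) in H; [|lra].
  replace (- (K * (4 * t ^ 2 / (1 + t ^ 2))) * (1 + t ^ 2)) with (- 4 * K * t ^ 2) in H by (field; lra).
  replace ((- 2 * p * t ^ 2 - 2 * q * t) / (1 + t ^ 2) * (1 + t ^ 2))
    with (- 2 * p * t ^ 2 - 2 * q * t) in H by (field; lra).
  lra. }
set (A := Rabs (2 * K - p) + 1).
assert (HA : 0 < A) by (unfold A; assert (H1 := Rabs_pos (2 * K - p)); lra).
assert (HA2 : 2 * K - p <= A - 1) by (unfold A; assert (H1 := Rle_abs (2 * K - p)); lra).
(* This t has the sign of q and is so small that the bound reads A q^2 <= (2K - p) q^2 <= (A - 1)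
   q^2, whence q = 0. *)
specialize (Ht (q / A)).
apply Rmult_le_compat_r with (r := A ^ 2) in Ht; [|nra].
replace (q * (q / A) * A ^ 2) with (A * q ^ 2) in Ht by (field; lra).
replace ((2 * K - p) * (q / A) ^ 2 * A ^ 2) with ((2 * K - p) * q ^ 2) in Ht by (field; lra).
assert (Hq : 0 <= q ^ 2) by nra. nra.
Qed.

Lemma CPSeries_bounded (a : nat -> C) (rho : R) :
  radius_ge_1 a -> 0 <= rho < 1 ->
  exists K, 0 <= K /\ forall z, Cmod z <= rho -> Cmod (CPSeries a z) <= K.
Proof.
intros Ha Hr.
assert (He := radius_ge_1_abs_summable a rho Ha Hr).
assert (Hp : forall k, 0 <= Cmod (a k) * rho ^ k).
{ intros k. apply Rmult_le_pos; [apply Cmod_ge_0 | apply pow_le; lra]. }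
exists (Series (fun k => Cmod (a k) * rho ^ k)). split; [now apply Series_ge_0|].
intros z Hz. assert (Hz0 := Cmod_ge_0 z).
assert (Hs := CPSeries_correct a z Ha ltac:(lra)).
assert (Hb : forall k, 0 <= Cmod (a k * z ^ k)%C <= Cmod (a k) * rho ^ k).
{ intros k. split; [apply Cmod_ge_0|]. rewrite Cmod_mult, Cmod_pow.
  apply Rmult_le_compat_l; [apply Cmod_ge_0 | apply pow_incr; lra]. }
eapply Rle_trans; [apply (Cmod_series_le _ _ Hs)|].
- apply ex_series_ext with (fun k => Cmod (a k) * Cmod z ^ k).
  + intros k. now rewrite Cmod_mult, Cmod_pow.
  + apply radius_ge_1_abs_summable; [exact Ha | lra].
- now apply Series_le.
Qed.

Lemma Re_CPSeries_lipschitz (a : nat -> C) (rho : R) :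
  radius_ge_1 a -> 0 <= rho < 1 ->
  exists L, lipschitz_on_disk (fun z => Re (CPSeries a z)) L rho.
Proof.
intros Ha Hr.
destruct (CPSeries_taylor a rho Ha Hr) as [K [HK HT]].
destruct (CPSeries_bounded _ rho (radius_ge_1_derive a Ha) Hr) as [D [HD HB]].
exists (D + 2 * K). split; [lra|]. intros z w Hz Hw.
specialize (HT z w Hz Hw). specialize (HB z Hz).
set (d := Cmod (w - z)%C) in *.
assert (Hd0 : 0 <= d) by apply Cmod_ge_0.
assert (Hd2 : d <= 2).
{ unfold d, Cminus. eapply Rle_trans; [apply Cmod_triangle|]. rewrite Cmod_opp. lra. }
change (Rabs (Re (CPSeries a w - CPSeries a z)%C) <= (D + 2 * K) * d).
eapply Rle_trans; [apply re_le_Cmod|].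
replace (CPSeries a w - CPSeries a z)%C with
  ((CPSeries a w - CPSeries a z - CPSeries (CPS_derive a) z * (w - z)) +
    CPSeries (CPS_derive a) z * (w - z))%C by ring.
eapply Rle_trans; [apply Cmod_triangle|]. rewrite (Cmod_mult (CPSeries _ z)). fold d.
assert (H1 : Cmod (CPSeries (CPS_derive a) z) * d <= D * d) by (apply Rmult_le_compat_r; lra).
assert (H2 : K * d ^ 2 <= K * (2 * d)) by (apply Rmult_le_compat_l; [lra | nra]).
lra.
Qed.

(* Jack's lemma in the form of Miller and Mocanu. *)
Lemma Re_minimum_on_circle (c : nat -> C) (n : nat) (gamma : R) (z0 : C) :
  (1 <= n)%nat -> radius_ge_1 c -> c 0%nat = RtoC 1 ->
  (forall k, (0 < k < n)%nat -> c k = RtoC 0) -> gamma < 1 -> Cmod z0 < 1 ->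
  Re (CPSeries c z0) = gamma ->
  (forall z, Cmod z = Cmod z0 -> gamma <= Re (CPSeries c z)) ->
  let W := (z0 * CPSeries (CPS_derive c) z0)%C in
  Im W = 0 /\
  INR n * ((1 - gamma) ^ 2 + Im (CPSeries c z0) ^ 2) <= - 2 * (1 - gamma) * Re W.
Proof.
intros Hn Hc Hc0 Hck Hg Hz0 Hre Hmin W. assert (Hz00 := Cmod_ge_0 z0).
assert (Hrot : forall zeta, Cmod zeta = 1 -> Cmod (z0 * zeta)%C = Cmod z0).
{ intros zeta Hz. rewrite Cmod_mult, Hz. ring. }
split.
(* As z0 is rotated along its circle, minimality and the Taylor estimate give a quadratic lower
   bound with constant K |z0|^2. *)
- destruct (CPSeries_taylor c (Cmod z0) Hc ltac:(lra)) as [K [HK HT]].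
  apply (Im_eq_0_of_quadratic_bound W (K * Cmod z0 ^ 2)). intros zeta Hz.
  specialize (HT z0 (z0 * zeta)%C (Rle_refl _) (Req_le _ _ (Hrot zeta Hz))).
  specialize (Hmin (z0 * zeta)%C (Hrot zeta Hz)).
  replace (z0 * zeta - z0)%C with (z0 * (zeta - 1))%C in HT by ring.
  replace (CPSeries (CPS_derive c) z0 * (z0 * (zeta - 1)))%C with (W * (zeta - 1))%C in HT
    by (unfold W; ring).
  rewrite Cmod_mult, Rpow_mult_distr in HT.
  assert (Hl := Rle_trans _ _ _ (re_le_Cmod _) HT). apply Rabs_le_between in Hl.
  replace (Re (CPSeries c (z0 * zeta) - CPSeries c z0 - W * (zeta - 1))%C)
    with (Re (CPSeries c (z0 * zeta)%C) - Re (CPSeries c z0) - Re (W * (zeta - 1))%C) in Hl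
    by (unfold Cminus, Cplus, Copp, Re; simpl; ring).
  lra.
(* These are the coefficients in zeta of [CPSeries c (z0 * zeta) - 1]: the constant term is 0, so
   b_k = 0 for all k < n, and the sum at zeta = 1 is [B]. *)
- pose (b k := match k with O => RtoC 0 | S _ => (c k * z0 ^ k)%C end).
  set (A := 1 - gamma). set (y := Im (CPSeries c z0)).
  set (B := (CPSeries c z0 - 1)%C).
  assert (HBe : B = (- A, y)).
  { unfold B, y, A. rewrite <- Hre. generalize (CPSeries c z0). intros [u v].
    unfold Cminus, Cplus, Copp, RtoC, Re, Im; simpl. f_equal; ring. }
  set (D := A ^ 2 + y ^ 2).
  assert (HA : 0 < A) by (unfold A; lra).
  assert (HD : 0 < D) by (unfold D; nra).
  (* This is -conj B / B for B = -A + iy. Then lambda B = A + iy and Re lambda - 1 = -2 A^2/D, and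
     multiplying the boundary inequality by D/A gives the claim. *)
  pose (lambda := ((y ^ 2 - A ^ 2) / D, - 2 * A * y / D) : C).
  assert (Hl : Cmod lambda = 1).
  { unfold Cmod, lambda; simpl fst; simpl snd. transitivity (sqrt 1); [f_equal | exact sqrt_1].
    unfold D in *. field. lra. }
  assert (Hs := CPSeries_correct c z0 Hc Hz0).
  assert (HB : is_series b B).
  { replace B with (b 0%nat + (CPSeries c z0 - sum_n (fun k => (c k * z0 ^ k)%C) 0))%C.
    - apply is_series_C_cons. exact (is_series_C_tail _ _ 0 Hs).
    - rewrite sum_O, Hc0. unfold B. simpl. ring. }
  assert (HW : is_series (fun k => (INR k * b k)%C) W).
  { replace W with (INR 0 * b 0%nat + W)%C by (simpl; ring).
    apply (is_series_C_cons (fun k => (INR k * b k)%C)).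
    apply is_series_C_ext with (fun k => (z0 * (CPS_derive c k * z0 ^ k))%C).
    - intros k. unfold CPS_derive, b. rewrite Cpow_S. ring.
    - apply is_series_C_scal, CPSeries_correct; [now apply radius_ge_1_derive | exact Hz0]. }
  assert (Habs : ex_series (fun k => INR k * Cmod (b k))).
  { apply ex_series_incr_1.
    apply ex_series_ext with (fun k => Cmod z0 * (Cmod (CPS_derive c k) * Cmod z0 ^ k)).
    - intros k. unfold CPS_derive, b. rewrite !Cmod_mult, Cmod_R, Cmod_pow, Rabs_pos_eq by apply pos_INR.
      R_eq. simpl pow. ring.
    - apply (@ex_series_scal R_AbsRing R_NormedModule (Cmod z0) (fun k => Cmod (CPS_derive c k) * Cmod z0 ^ k)).
      apply radius_ge_1_abs_summable; [now apply radius_ge_1_derive | lra]. }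
  assert (H := boundary_inequality b n lambda B W Hn).
  assert (H' : 0 <= (Re lambda - 1) * Re W - INR n * Re (lambda * B)%C).
  { apply H; try assumption.
    - intros [|k] Hk; [reflexivity|]. unfold b. rewrite Hck by lia. ring.
    - intros zeta l Hz Hser.
      assert (Hs' := CPSeries_correct c (z0 * zeta)%C Hc ltac:(rewrite Hrot; assumption)).
      assert (E : l = (CPSeries c (z0 * zeta) - CPSeries c z0)%C).
      { apply (is_series_C_unique _ _ _ Hser).
        apply is_series_C_ext with (2 := is_series_C_minus _ _ _ _ Hs' Hs).
        intros [|k]; [simpl; ring|]. unfold b. rewrite Cpow_mult_l. ring. }
      rewrite E. specialize (Hmin _ (Hrot zeta Hz)).
      change (0 <= Re (CPSeries c (z0 * zeta)%C) - Re (CPSeries c z0)). lra. }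
  rewrite HBe in H'.
  replace (Re (Cmult lambda (- A, y))) with A in H' by (unfold lambda, D in *; simpl; field; lra).
  replace (Re lambda - 1) with (- 2 * A ^ 2 / D) in H' by (unfold lambda, D in *; simpl; field; lra).
  apply Rmult_le_compat_r with (r := D / A) in H'; [|left; apply Rdiv_lt_0_compat; assumption].
  replace ((- 2 * A ^ 2 / D * Re W - INR n * A) * (D / A)) with (- 2 * A * Re W - INR n * D) in H'
    by (field; lra).
  lra.
Qed.

(** * Removable singularities *)

Lemma merom_value_unique (g : C -> C) (z v1 v2 : C) :
  merom_value g z v1 -> merom_value g z v2 -> v1 = v2.
Proof.
intros H1 H2. now rewrite <- (is_C_lim_unique _ _ _ H1), <- (is_C_lim_unique _ _ _ H2).
Qed.

Lemma merom_value_ext (g h : C -> C) (z v : C) :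
  @locally (AbsRing_UniformSpace C_AbsRing) z (fun w => w <> z -> g w = h w) ->
  merom_value g z v -> merom_value h z v.
Proof.
intros E H. apply locally_C in E. apply filterlim_ext_loc with (2 := H). exact E.
Qed.

Lemma merom_value_mult (g h : C -> C) (z u v : C) :
  merom_value g z u -> merom_value h z v -> merom_value (fun w => (g w * h w)%C) z (u * v)%C.
Proof.
intros Hg Hh.
apply filterlim_comp_2 with (1 := Hg) (2 := Hh).
(* Continuity of multiplication is available for the balls of the modulus and is carried over to
   product balls. *)
intros P HP. apply locally_C in HP.
destruct (@filterlim_mult C_AbsRing u v P HP) as [Q R HQ HR HQR].
apply locally_C in HQ. apply locally_C in HR.
now exists Q R.
Qed.

Lemma merom_value_derivable (g : C -> C) (z d : C) :
  @is_derive C_AbsRing C_NormedModule g z d -> merom_value g z (g z).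
Proof.
intros H P HP. assert (Hc := ex_derive_continuous g z (ex_intro _ d H) P HP).
apply locally_C in Hc.
apply (filter_imp (F := @locally C_UniformSpace z)) with (2 := Hc). intros w Hw _. exact Hw.
Qed.

Lemma is_series_C_drop_zeros (a : nat -> C) (m : nat) (l : C) :
  (forall k, (k < m)%nat -> a k = RtoC 0) -> is_series a l ->
  is_series (fun k => a (m + k)%nat) l.
Proof.
intros Ha H. destruct m as [|m]; [exact H|].
assert (E : (l - sum_n a m)%C = l).
{ replace (sum_n a m : C) with (RtoC 0); [ring|].
  symmetry. transitivity (sum_n (fun _ => RtoC 0) m : C).
  - apply sum_n_C_ext. intros k Hk. apply Ha. lia.
  - rewrite sum_n_C_const. ring. }
rewrite <- E. now apply is_series_C_tail.
Qed.

(** Serves to split off the zero of f' at the origin, with m = p - 1 and s = p. *)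
Lemma CPSeries_factor (a c : nat -> C) (m : nat) (s z : C) :
  radius_ge_1 a -> radius_ge_1 c -> Cmod z < 1 ->
  (forall k, (k < m)%nat -> a k = RtoC 0) ->
  (forall k, a (m + k)%nat = (s * c k)%C) ->
  CPSeries a z = (s * z ^ m * CPSeries c z)%C.
Proof.
intros Ha Hc Hz H0 Hm.
assert (H1 : is_series (fun k => (a (m + k)%nat * z ^ (m + k))%C) (CPSeries a z)).
{ apply (is_series_C_drop_zeros (fun k => (a k * z ^ k)%C)); [|now apply CPSeries_correct].
  intros k Hk. rewrite (H0 k Hk). ring. }
apply (is_series_C_unique _ _ _ H1).
apply is_series_C_ext with (2 := is_series_C_scal (s * z ^ m)%C _ _ (CPSeries_correct c z Hc Hz)).
intros k. simpl. rewrite Hm, Cpow_add_r. ring.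
Qed.

Lemma CPSeries_0 (a : nat -> C) : CPSeries a (RtoC 0) = a 0%nat.
Proof.
apply CSeries_unique. apply filterlim_ext with (fun _ => a 0%nat); [|apply filterlim_const].
intros N. induction N as [|N IH].
- rewrite sum_O. C_eq. simpl. ring.
- assert (IH' : a 0%nat = sum_n (fun k => (a k * 0 ^ k)%C) N :> C) by exact IH.
  rewrite sum_n_C_S, <- IH'. C_eq. rewrite Cpow_S. ring.
Qed.

Lemma continuous_neq_0 (g : C -> C) (z d : C) :
  @is_derive C_AbsRing C_NormedModule g z d -> g z <> RtoC 0 ->
  @locally (AbsRing_UniformSpace C_AbsRing) z (fun w => g w <> RtoC 0).
Proof.
intros H Hz. apply (ex_derive_continuous g z (ex_intro _ d H) (fun v => v <> RtoC 0)).
apply locally_C, locally_C_ball with (Cmod (g z)); [now apply Cmod_gt_0|].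
intros w Hw E. rewrite E in Hw.
replace (0 - g z)%C with (- g z)%C in Hw by ring. rewrite Cmod_opp in Hw. lra.
Qed.

Lemma C_derive_CPSeries (a : nat -> C) (f : C -> C) (z : C) :
  radius_ge_1 a -> (forall w, Cmod w < 1 -> f w = CPSeries a w) -> Cmod z < 1 ->
  C_derive f z = CPSeries (CPS_derive a) z.
Proof.
intros Ha Hf Hz. apply is_C_derive_unique.
apply is_derive_ext_loc with (CPSeries a).
- apply locally_disk; [exact Hz|]. intros w Hw. symmetry. now apply Hf.
- now apply is_derive_CPSeries.
Qed.

(** [C_AbsRing] as a module over itself has the same norm as [C_NormedModule], so the remainder
    estimate of [is_derive_mult] transfers as it is; only linearity is proved anew for the other
    structure. *)
Lemma is_derive_Cmult (f g : C -> C) (z df dg : C) :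
  @is_derive C_AbsRing C_NormedModule f z df -> @is_derive C_AbsRing C_NormedModule g z dg ->
  @is_derive C_AbsRing C_NormedModule (fun w => (f w * g w)%C) z (df * g z + f z * dg)%C.
Proof.
intros [_ Hf] [_ Hg].
destruct (@is_derive_mult C_AbsRing f g z df dg) as [_ H].
- split; [apply is_linear_scal_l | exact Hf].
- split; [apply is_linear_scal_l | exact Hg].
- exact Cmult_comm.
- split; [apply is_linear_scal_l | exact H].
Qed.

Lemma is_derive_C_id (z : C) : @is_derive C_AbsRing C_NormedModule (fun w => w) z (RtoC 1).
Proof.
destruct (@is_derive_id C_AbsRing z) as [_ H]. split; [apply is_linear_scal_l | exact H].
Qed.

(** The derivative is described through z times it, which avoids the exponent m - 1 and is the form
    in which z f'' enters. *)
Lemma is_derive_monomial_mult (g : C -> C) (m : nat) (s z d : C) :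
  @is_derive C_AbsRing C_NormedModule g z d ->
  exists e, @is_derive C_AbsRing C_NormedModule (fun w => (s * w ^ m * g w)%C) z e /\
    (z * e = s * z ^ m * (INR m * g z + z * d))%C.
Proof.
intros Hg. induction m as [|m [e [He Ee]]].
- exists (s * d)%C. split; [|simpl; ring].
  apply is_derive_ext with (fun w => (s * g w)%C).
  + intros w. simpl. C_eq. ring.
  + replace (s * d)%C with (0 * g z + s * d)%C by ring.
    apply is_derive_Cmult; [exact (@is_derive_const C_AbsRing C_NormedModule s z) | exact Hg].
- exists (1 * (s * z ^ m * g z) + z * e)%C. split.
  + apply is_derive_ext with (fun w => (w * (s * w ^ m * g w))%C).
    * intros w. rewrite Cpow_S. C_eq. ring.
    * exact (is_derive_Cmult _ _ _ _ _ (is_derive_C_id z) He).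
  + rewrite Cmult_plus_distr_l, Ee, S_INR, RtoC_plus, Cpow_S. ring.
Qed.

Theorem theorem2p1 (p n : nat) (alpha : R) (f : C -> C) :
  (1 <= p)%nat -> (1 <= n)%nat -> (0 <= alpha < 1)%R ->
  class_A p n f ->
  Re_gt_on_disk
    (fun z : C => (1 + z * C_derive (C_derive f) z / C_derive f z)%C)
    (((2 * INR p - INR n) + alpha * (2 * INR p + INR n)) / (2 * (alpha + 1)))%R ->
  Re_gt_on_disk
    (fun z : C => (C_derive f z / (RtoC (INR p) * z ^ (p - 1)))%C)
    ((1 + alpha) / 2)%R.
Proof.
intros Hp Hn Halpha [_ [a [Ha0 [Hap [Han Hf]]]]] Hyp.
assert (Ha : radius_ge_1 a) by exact (is_pseries_disk_radius a f Hf).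
set (e := CPS_derive a).
assert (He : radius_ge_1 e) by now apply radius_ge_1_derive.
assert (HpC : RtoC (INR p) <> RtoC 0).
{ intros E. apply RtoC_inj in E. revert E. apply not_0_INR. lia. }
(* These are the coefficients ((p + k)/p) a_(p+k) of q = f'/(p z^(p-1)). Dropping the p - 1
   vanishing terms of f' removes the singularity at 0. *)
set (c k := (/ INR p * e (p - 1 + k)%nat)%C).
assert (Hc : radius_ge_1 c).
{ apply radius_ge_1_scal; [|now apply (radius_ge_1_shift e)].
  intros E. apply HpC. replace (RtoC (INR p)) with (INR p * INR p * / INR p)%C by (field; exact HpC).
  rewrite E. ring. }
assert (Hc0 : c 0%nat = RtoC 1).
{ unfold c, e, CPS_derive. replace (S (p - 1 + 0)) with p by lia. rewrite Hap. field. exact HpC. }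
assert (Hck : forall k, (0 < k < n)%nat -> c k = RtoC 0).
{ intros k Hk. unfold c, e, CPS_derive. rewrite Han by lia. ring. }
set (q := CPSeries c).
assert (Hf1 : forall z, Cmod z < 1 -> C_derive f z = CPSeries e z).
{ intros z Hz. apply C_derive_CPSeries; [exact Ha | | exact Hz].
  intros w Hw. symmetry. apply CPSeries_unique, Hf, Hw. }
assert (Hf2 : forall z, Cmod z < 1 -> C_derive (C_derive f) z = CPSeries (CPS_derive e) z).
{ intros z Hz. now apply C_derive_CPSeries. }
assert (Hfq : forall z, Cmod z < 1 -> CPSeries e z = (INR p * z ^ (p - 1) * q z)%C).
{ intros z Hz. apply CPSeries_factor; trivial.
  - intros k Hk. unfold e, CPS_derive. rewrite Ha0 by lia. ring.
  - intros k. unfold c. field. exact HpC. }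
set (gamma := (1 + alpha) / 2).
assert (Hq : forall z, Cmod z < 1 -> gamma < Re (q z)).
{ intros z1 Hz1. apply Rnot_le_lt. intros Hle.
  destruct (Re_CPSeries_lipschitz c (Cmod z1) Hc (conj (Cmod_ge_0 z1) Hz1)) as [L HL].
  assert (Hq0 : q (RtoC 0) = RtoC 1).
  { unfold q. now rewrite CPSeries_0. }
  destruct (first_crossing _ L (Cmod z1) gamma z1 HL) as [z0 [Hz0 [Hg Hmin]]].
  { fold q. rewrite Hq0. simpl. unfold gamma. lra. }
  { apply Rle_refl. }
  { exact Hle. }
  fold q in Hg, Hmin.
  assert (Hz01 : Cmod z0 < 1) by lra.
  (* Since q(0) = 1 > gamma, the crossing point is not 0, and z0^(p-1) can be divided out. *)
  assert (Hz0n : z0 <> RtoC 0).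
  { intros E. rewrite E, Hq0 in Hg. simpl in Hg. unfold gamma in Hg. lra. }
  destruct (Re_minimum_on_circle c n gamma z0 Hn Hc Hc0 Hck) as [HIm HRe]; trivial.
  { unfold gamma; lra. }
  { intros z Hz. apply Hmin. lra. }
  fold q in HIm, HRe.
  (* Differentiating f' = p z^(p-1) q gives z0 f''(z0) = p z0^(p-1) ((p-1) q(z0) + z0 q'(z0)). *)
  destruct (is_derive_monomial_mult q (p - 1) (INR p) z0 _ (is_derive_CPSeries c z0 Hc Hz01)) as [d [Hd Ed]].
  destruct (Hyp z0 Hz01) as [v [Hv Hvc]].
  assert (Hd' : CPSeries (CPS_derive e) z0 = d).
  { rewrite <- Hf2 by exact Hz01. apply is_C_derive_unique.
    apply is_derive_ext_loc with (2 := Hd). apply locally_disk; [exact Hz01|].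
    intros w Hw. rewrite Hf1, Hfq by exact Hw. reflexivity. }
  assert (HFder := is_derive_CPSeries e z0 He Hz01).
  assert (HGder := is_derive_Cmult _ _ _ _ _ (is_derive_C_id z0)
     (is_derive_CPSeries _ z0 (radius_ge_1_derive e He) Hz01)).
  assert (Hlim2 := merom_value_derivable _ _ _ (is_derive_plus _ _ _ _ _ HFder HGder)).
  assert (HF0 : CPSeries e z0 <> RtoC 0).
  { rewrite Hfq by exact Hz01. apply Cmult_neq_0; [apply Cmult_neq_0; [exact HpC | now apply Cpow_nz]|].
    intros E. rewrite E in Hg. simpl in Hg. unfold gamma in Hg. lra. }
  assert (Hlim1 := merom_value_mult _ _ _ _ _ Hv (merom_value_derivable _ _ _ HFder)).
  (* Off the zeros of f', the product of 1 + z f''/f' with f' is f' + z f''. As f'(z0) is not 0,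
     this holds near z0, and uniqueness of limits gives the identity at z0. *)
  assert (E : (v * CPSeries e z0 = CPSeries e z0 + z0 * d)%C).
  { apply (merom_value_unique (fun w => plus (CPSeries e w) (w * CPSeries (CPS_derive e) w)%C) z0).
    - apply merom_value_ext with (2 := Hlim1).
      generalize (continuous_neq_0 _ _ _ HFder HF0) (locally_disk z0 _ Hz01 (fun w Hw => Hw)).
      intros HA HB. generalize (filter_and _ _ HA HB). apply filter_imp.
      intros w [Hw0 Hw] _. rewrite Hf2, Hf1 by exact Hw.
      change (plus ?u ?v) with (u + v)%C. field. exact Hw0.
    - rewrite <- Hd'. exact Hlim2. }
  (* Division by p z0^(p-1); the terms 1 and p - 1 combine to p. *)
  assert (E1 : (v * q z0 = INR p * q z0 + z0 * CPSeries (CPS_derive c) z0)%C).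
  { rewrite Ed, Hfq in E by exact Hz01.
    assert (Hs : (INR p * z0 ^ (p - 1))%C <> RtoC 0) by (apply Cmult_neq_0; [exact HpC | now apply Cpow_nz]).
    assert (Hpm : INR p = INR (p - 1) + 1) by (rewrite <- S_INR; f_equal; lia).
    rewrite Hpm at 1. rewrite RtoC_plus.
    transitivity (v * (INR p * z0 ^ (p - 1) * q z0) / (INR p * z0 ^ (p - 1)))%C.
    - field. split; [now apply Cpow_nz | exact HpC].
    - rewrite E. field. split; [now apply Cpow_nz | exact HpC]. }
  revert HIm HRe E1 Hvc. generalize (z0 * CPSeries (CPS_derive c) z0)%C. intros W.
  destruct W as [w w2], v as [v1 v2], (q z0) as [g y]. unfold Re, Im in *; simpl fst in *; simpl snd in *.
  subst g. intros -> HRe E1 Hvc. apply (f_equal fst) in E1 as E2. apply (f_equal snd) in E1.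
  unfold Cmult, Cplus, RtoC in E1, E2. simpl fst in *; simpl snd in *.
  assert (Hgam : 1 / 2 <= gamma < 1) by (unfold gamma; lra).
  assert (Hn0 : 1 <= INR n) by (apply (le_INR 1); exact Hn).
  (* The assumed bound in terms of gamma, from 2 gamma = 1 + alpha and 2 (1 - gamma) = 1 - alpha. *)
  replace (_ / (2 * (alpha + 1))) with (INR p - INR n * (1 - gamma) / (2 * gamma)) in Hvc
    by (unfold gamma; field; lra).
  (* Real part of (v - p) q = w after multiplication by conj q, where q = gamma + iy and w is
     real. *)
  assert (Ev : (v1 - INR p) * (gamma ^ 2 + y ^ 2) = w * gamma).
  { replace (w * gamma) with ((v1 * gamma - v2 * y - INR p * gamma) * gamma) by (rewrite E2; ring).
    replace (v2 * y) with (v2 * gamma / gamma * y) by (field; lra).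
    replace (v2 * gamma) with (INR p * y - v1 * y) by lra. field. lra. }
  assert (Hlow : - INR n * (1 - gamma) * (gamma ^ 2 + y ^ 2) < 2 * gamma * (w * gamma)).
  { rewrite <- Ev.
    replace (- INR n * (1 - gamma) * (gamma ^ 2 + y ^ 2))
      with (2 * gamma * (- (INR n * (1 - gamma) / (2 * gamma)) * (gamma ^ 2 + y ^ 2))) by (field; lra).
    apply Rmult_lt_compat_l; [lra|]. apply Rmult_lt_compat_r; [nra | lra]. }
  assert (Hup : gamma ^ 2 * (INR n * ((1 - gamma) ^ 2 + y ^ 2)) <= gamma ^ 2 * (-2 * (1 - gamma) * w))
    by (apply Rmult_le_compat_l; [nra | exact HRe]).
  (* Chaining [Hup] with [Hlow] times 1 - gamma eliminates w; cancelling n then leaves gamma^2 y^2 <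
     (1 - gamma)^2 y^2. *)
  assert (Hmul : INR n * (gamma ^ 2 * ((1 - gamma) ^ 2 + y ^ 2))
            < INR n * ((1 - gamma) ^ 2 * (gamma ^ 2 + y ^ 2))).
  { apply Rmult_lt_compat_l with (r := 1 - gamma) in Hlow; lra. }
  apply Rmult_lt_reg_l in Hmul; [|lra].
  (* The contradiction: gamma >= 1/2, that is alpha >= 0, gives the opposite inequality. *)
  assert (Hy : (1 - gamma) ^ 2 * y ^ 2 <= gamma ^ 2 * y ^ 2) by (apply Rmult_le_compat_r; nra).
  lra. }
intros z Hz. exists (q z). split; [|apply Hq, Hz].
apply merom_value_ext with q.
(* A small punctured neighbourhood of z avoids 0, also when z = 0, and there the quotient agrees
   with q. *)
- assert (Hnz : @locally (AbsRing_UniformSpace C_AbsRing) z (fun w => w <> z -> w <> RtoC 0)).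
  { destruct (Ceq_dec z (RtoC 0)) as [->|Hz0]; [apply locally_disk; trivial|].
    generalize (continuous_neq_0 _ _ _ (is_derive_C_id z) Hz0). apply filter_imp. trivial. }
  generalize (filter_and _ _ Hnz (locally_disk z _ Hz (fun w Hw => Hw))). apply filter_imp.
  intros w [Hw0 Hw] Hwz. specialize (Hw0 Hwz).
  rewrite Hf1, Hfq by exact Hw. field. split; [now apply Cpow_nz | exact HpC].
- exact (merom_value_derivable _ _ _ (is_derive_CPSeries c z Hc Hz)).
Qed.
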